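(* Let $\Lambda=\Lambda_{(\phi,\psi)}=\begin{pmatrix} A & {}_AN_B \\ {}_BM_A & B\end{pmatrix}$ be a Morita ring. (1) The recollement $((B/\operatorname{Im}\phi)\text{-}\mathrm{Mod},\ \Lambda\text{-}\mathrm{Mod},\ A\text{-}\mathrm{Mod},\ Q_B,Z_B,P_B,T_A,U_A,H_A)$ satisfies condition (P) if and only if $\phi$ is a monomorphism. (2) The recollement $((A/\operatorname{Im}\psi)\text{-}\mathrm{Mod},\ \Lambda\text{-}\mathrm{Mod},\ B\text{-}\mathrm{Mod},\ Q_A,Z_A,P_A,T_B,U_B,H_B)$ satisfies condition (P) if and only if $\psi$ is a monomorphism.
   Context: Morita rings. Let $A,B$ be rings, ${}_BM_A$ and ${}_AN_B$ bimodules, $\phi:M\otimes_AN\to B$ a $B$-bimodule map and $\psi:N\otimes_BM\to A$ an $A$-bimodule map such that $m'\psi(n\otimes m)=\phi(m'\otimes n)m$ and $n'\phi(m\otimes n)=\psi(n'\otimes m)n$ for all $m,m'\in M$, $n,n'\in N$. The Morita ring $\Lambda_{(\phi,\psi)}=\begin{pmatrix} A & N \\ M & B \end{pmatrix}$ has componentwise addition and multiplication $\begin{pmatrix} a & n \\ m & b \end{pmatrix}\begin{pmatrix} a' & n' \\ m' & b' \end{pmatrix}=\begin{pmatrix} aa'+\psi(n\otimes m') & an'+nb' \\ ma'+bm' & \phi(m\otimes n')+bb' \end{pmatrix}$. Left $\Lambda$-modules are identified with quadruples $\begin{pmatrix} X \\ Y \end{pmatrix}_{f,g}$, where $X\in A\text{-}\mathrm{Mod}$,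 $Y\in B\text{-}\mathrm{Mod}$, $f\in\operatorname{Hom}_B(M\otimes_AX,Y)$, $g\in\operatorname{Hom}_A(N\otimes_BY,X)$ satisfy $g(n\otimes f(m\otimes x))=\psi(n\otimes m)x$ and $f(m\otimes g(n\otimes y))=\phi(m\otimes n)y$; homomorphisms are pairs $(a,b)$ of an $A$-map and a $B$-map compatible with the $f$'s and $g$'s. $\tilde f:X\to\operatorname{Hom}_B(M,Y)$, $\tilde g:Y\to\operatorname{Hom}_A(N,X)$ are the adjoints of $f$, $g$. Let $\Psi_X:N\otimes_BM\otimes_AX\to X$ and $\Phi_Y:M\otimes_AN\otimes_BY\to Y$ be the maps induced by $\psi$ and $\phi$, let $\widetilde{\Psi_X}:M\otimes_AX\to\operatorname{Hom}_A(N,X)$ and $\widetilde{\Phi_Y}:N\otimes_BY\to\operatorname{Hom}_B(M,Y)$ be their adjoints, and let $\epsilon'_X:N\otimes_B\operatorname{Hom}_A(N,X)\to X$ and $\epsilon_Y:M\otimes_A\operatorname{Hom}_B(M,Y)\to Y$ be the evaluation maps. First recollement (induced by the idempotent $\begin{pmatrix} 1_A & 0 \\ 0 & 0 \end{pmatrix}$), with functors in the order $(i^*,i_*,i^!,j_!,j^*,j_* )=(Q_B,Z_B,P_B,T_A,U_A,H_A)$: $Q_B\begin{pmatrix} X \\ Y \end{pmatrix}_{f,g}=B/\operatorname{Im}\phi\otimes_B\operatorname{Coker}f$; $Z_B(Y)=\begin{pmatrix} 0 \\ Y \end{pmatrix}_{0,0}$; $P_B\begin{pmatrix} X \\ Y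 \end{pmatrix}_{f,g}=B/\operatorname{Im}\phi\otimes_B\operatorname{Ker}\tilde g$; $T_A(X)=\begin{pmatrix} X \\ M\otimes_AX \end{pmatrix}_{1,\Psi_X}$; $U_A\begin{pmatrix} X \\ Y \end{pmatrix}_{f,g}=X$; $H_A(X)=\begin{pmatrix} X \\ \operatorname{Hom}_A(N,X) \end{pmatrix}_{\widetilde{\Psi_X},\epsilon'_X}$. Second recollement (induced by $\begin{pmatrix} 0 & 0 \\ 0 & 1_B \end{pmatrix}$), with $(i^*,i_*,i^!,j_!,j^*,j_* )=(Q_A,Z_A,P_A,T_B,U_B,H_B)$: $Q_A\begin{pmatrix} X \\ Y \end{pmatrix}_{f,g}=A/\operatorname{Im}\psi\otimes_A\operatorname{Coker}g$; $Z_A(X)=\begin{pmatrix} X \\ 0 \end{pmatrix}_{0,0}$; $P_A\begin{pmatrix} X \\ Y \end{pmatrix}_{f,g}=A/\operatorname{Im}\psi\otimes_A\operatorname{Ker}\tilde f$; $T_B(Y)=\begin{pmatrix} N\otimes_BY \\ Y \end{pmatrix}_{\Phi_Y,1}$; $U_B\begin{pmatrix} X \\ Y \end{pmatrix}_{f,g}=Y$; $H_B(Y)=\begin{pmatrix} \operatorname{Hom}_B(M,Y) \\ Y \end{pmatrix}_{\epsilon_Y,\widetilde{\Phi_Y}}$. In each case $(i^*,i_* )$, $(i_*,i^!)$, $(j_!,j^* )$, $(j^*,j_* )$ are adjoint pairs, $i_*,j_!,j_*$ are fully faithful and $\operatorname{Ker}j^*=\operatorname{Im}i_*$. A recollement $(\mathcal{A}',\mathcal{A},\mathcal{A}'',i^*,i_*,i^!,j_!,j^*,j_*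 )$ satisfies condition (P) if $\varepsilon_P:j_!j^*P\to P$ is a monomorphism for every projective object $P$ of $\mathcal{A}$, where $\varepsilon:j_!j^*\to1_{\mathcal{A}}$ is the counit of $(j_!,j^* )$. *)

(* Defs.v *)
From HB Require Import structures.
From mathcomp Require Import all_boot all_algebra.
From mathcomp Require Import generic_quotient ring_quotient boolp.

Set Implicit Arguments.
Unset Strict Implicit.
Unset Printing Implicit Defensive.

Import GRing.Theory.
Local Open Scope ring_scope.
Local Open Scope quotient_scope.

#[local] Obligation Tactic := idtac.

Lemma lin_ext (R : pzRingType) (U V : lmodType R) (f g : {linear U -> V}) :
  f =1 g -> f = g.
Proof.
case: f g => f [[cf] [sf]] [g [[cg] [sg]]] /= fg.
have {}fg : f = g by apply/funext.
by subst g; rewrite (Prop_irrelevance cf cg) (Prop_irrelevance sf sg).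
Qed.

Definition mk_lin (R : pzRingType) (U V : lmodType R) (f : U -> V)
    (lf : linear f) : {linear U -> V} :=
  HB.pack f (GRing.isLinear.Build R U V *:%R f lf).

Definition id_lin (R : pzRingType) (X : lmodType R) : {linear X -> X} := idfun.
Definition comp_lin (R : pzRingType) (X Y Z : lmodType R)
  (g : {linear Y -> Z}) (f : {linear X -> Y}) : {linear X -> Z} := g \o f.

Lemma id_linE (R : pzRingType) (X : lmodType R) (x : X) : id_lin X x = x.
Proof. by []. Qed.
Lemma comp_linE (R : pzRingType) (X Y Z : lmodType R)
  (g : {linear Y -> Z}) (f : {linear X -> Y}) x : comp_lin g f x = g (f x).
Proof. by []. Qed.

(* [bimod B A] is the type of B-A-bimodules: left scaling is [b *: m], right *)
(* scaling is [ract m a]. *)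
Record bimod (B A : pzRingType) := Bimod {
  bimod_sort :> lmodType B;
  ract : bimod_sort -> A -> bimod_sort;
  ractDl : forall m m' a, ract (m + m') a = ract m a + ract m' a;
  ractDr : forall m a a', ract m (a + a') = ract m a + ract m a';
  ractA : forall m a a', ract (ract m a) a' = ract m (a * a');
  ract1 : forall m, ract m 1 = m;
  ractZ : forall b m a, ract (b *: m) a = b *: ract m a
}.

Program Definition reg_bimod (B : pzRingType) : bimod B B :=
  @Bimod B B B^o (fun x b => x * b) _ _ _ _ _.
Next Obligation. by move=> B m m' a /=; rewrite mulrDl. Qed.
Next Obligation. by move=> B m a a' /=; rewrite mulrDr. Qed.
Next Obligation. by move=> B m a a' /=; rewrite mulrA. Qed.
Next Obligation. by move=> B m /=; rewrite mulr1. Qed.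
Next Obligation. by move=> B b m a /=; rewrite -mulrA. Qed.

Record bimod_hom (B A : pzRingType) (U V : bimod B A) := BimodHom {
  bimod_fun :> {linear U -> V};
  bimod_funR : forall u a, bimod_fun (ract u a) = ract (bimod_fun u) a
}.

Section Tensor.
Variables (B A : pzRingType) (M : bimod B A) (X : lmodType A).

(* A formal sum of pure tensors m (x) x is a sequence of pairs (m, x); *)
(* negatives are represented by (- m) (x) x. *)
Inductive tens_rel : seq (M * X) -> seq (M * X) -> Prop :=
| tens_refl s : tens_rel s s
| tens_sym s t : tens_rel s t -> tens_rel t s
| tens_trans s t u : tens_rel s t -> tens_rel t u -> tens_rel s u
| tens_cat s s' t t' :
    tens_rel s s' -> tens_rel t t' -> tens_rel (s ++ t) (s' ++ t')
| tens_comm s t : tens_rel (s ++ t) (t ++ s)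
| tens_zero x : tens_rel [:: (0, x)] [::]
| tens_addl m m' x : tens_rel [:: (m + m', x)] [:: (m, x); (m', x)]
| tens_addr m x x' : tens_rel [:: (m, x + x')] [:: (m, x); (m, x')]
| tens_bal m a x : tens_rel [:: (ract m a, x)] [:: (m, a *: x)].

Definition tens_relb : rel (seq (M * X)) := fun s t => `[< tens_rel s t >].

Lemma tens_relb_equiv : equiv_class_of tens_relb.
Proof.
split=> [s|s t|t s u].
- by apply/asboolP; apply: tens_refl.
- by apply/asboolP/asboolP; apply: tens_sym.
- by move=> /asboolP h /asboolP h'; apply/asboolP; apply: tens_trans h h'.
Qed.

Canonical tens_equiv := EquivRelPack tens_relb_equiv.

Definition tensor := {eq_quot tens_relb}.

HB.instance Definition _ := Choice.on tensor.

Definition tpi (s : seq (M * X)) : tensor := \pi_tensor s.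

Lemma tpiP s t : tpi s = tpi t <-> tens_rel s t.
Proof.
split; first by move/eqmodP/asboolP.
by move=> h; apply/eqmodP/asboolP.
Qed.

Lemma tpi_surj (t : tensor) : exists s, t = tpi s.
Proof. by exists (repr t); rewrite /tpi reprK. Qed.

Lemma repr_rel s : tens_rel (repr (tpi s)) s.
Proof. by apply/tpiP; rewrite /tpi reprK. Qed.

Definition tadd (t u : tensor) : tensor := tpi (repr t ++ repr u).
Definition tscale_seq (b : B) (s : seq (M * X)) : seq (M * X) :=
  [seq (b *: p.1, p.2) | p <- s].
Definition tscale (b : B) (t : tensor) : tensor := tpi (tscale_seq b (repr t)).
Definition topp (t : tensor) : tensor := tscale (-1) t.

Lemma tadd_pi s t : tadd (tpi s) (tpi t) = tpi (s ++ t).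
Proof. by apply/tpiP; apply: tens_cat; apply: repr_rel. Qed.

Lemma tscale_rel b s t :
  tens_rel s t -> tens_rel (tscale_seq b s) (tscale_seq b t).
Proof.
elim=> {s t} [s|s t _|s t u _ h1 _ h2|s s' t t' _ h1 _ h2|s t|x|m m' x|m x x'|m a x];
  rewrite /tscale_seq ?map_cat /=.
- exact: tens_refl.
- exact: tens_sym.
- exact: tens_trans h1 h2.
- exact: tens_cat.
- exact: tens_comm.
- by rewrite scaler0; apply: tens_zero.
- by rewrite scalerDr; apply: tens_addl.
- exact: tens_addr.
- by rewrite -ractZ; apply: tens_bal.
Qed.

Lemma tscale_pi b s : tscale b (tpi s) = tpi (tscale_seq b s).
Proof. by apply/tpiP; apply: tscale_rel; apply: repr_rel. Qed.

Lemma taddA : associative tadd.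
Proof.
move=> t u v; have [[[s ->] [s' ->]] [s'' ->]] := (tpi_surj t, tpi_surj u, tpi_surj v).
by rewrite !tadd_pi catA.
Qed.

Lemma taddC : commutative tadd.
Proof.
move=> t u; have [[s ->] [s' ->]] := (tpi_surj t, tpi_surj u).
by rewrite !tadd_pi; apply/tpiP; apply: tens_comm.
Qed.

Lemma tadd0 : left_id (tpi [::]) tadd.
Proof. by move=> t; have [s ->] := tpi_surj t; rewrite tadd_pi. Qed.

Lemma tpi_cons p s : tpi (p :: s) = tadd (tpi [:: p]) (tpi s).
Proof. by rewrite tadd_pi. Qed.

Lemma tscaleDl_pi a b s :
  tpi (tscale_seq (a + b) s) = tpi (tscale_seq a s ++ tscale_seq b s).
Proof.
rewrite -tadd_pi; elim: s => [|p s IH] /=; first by rewrite tadd0.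
rewrite tpi_cons IH [tpi (_ :: tscale_seq a s)]tpi_cons.
rewrite [tpi (_ :: tscale_seq b s)]tpi_cons scalerDl.
have -> : tpi [:: (a *: p.1 + b *: p.1, p.2)]
        = tadd (tpi [:: (a *: p.1, p.2)]) (tpi [:: (b *: p.1, p.2)]).
  by rewrite tadd_pi; apply/tpiP; apply: tens_addl.
rewrite -!taddA; congr (tadd _ _); rewrite !taddA; congr (tadd _ _).
exact: taddC.
Qed.

Lemma tscale0_pi s : tpi (tscale_seq 0 s) = tpi [::].
Proof.
elim: s => [//|p s IH] /=; rewrite tpi_cons IH tadd_pi cats0 scale0r.
by apply/tpiP; apply: tens_zero.
Qed.

Lemma tscale_seq1 s : tscale_seq 1 s = s.
Proof. by elim: s => [//|[m x] s IH] /=; rewrite IH scale1r. Qed.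

Lemma taddN : left_inverse (tpi [::]) topp tadd.
Proof.
move=> t; have [s ->] := tpi_surj t.
rewrite /topp tscale_pi tadd_pi -[s in X in _ ++ X]tscale_seq1 -tscaleDl_pi.
by rewrite addNr tscale0_pi.
Qed.

HB.instance Definition _ := GRing.isZmodule.Build tensor taddA taddC tadd0 taddN.

Lemma tpi_cat s t : tpi (s ++ t) = tpi s + tpi t.
Proof. by rewrite -tadd_pi. Qed.

Lemma tscalerA a b t : tscale a (tscale b t) = tscale (a * b) t.
Proof.
have [s ->] := tpi_surj t; rewrite !tscale_pi; congr tpi.
by rewrite /tscale_seq -map_comp; apply: eq_map => p /=; rewrite scalerA.
Qed.

Lemma tscale1 : left_id 1 tscale.
Proof. by move=> t; have [s ->] := tpi_surj t; rewrite tscale_pi tscale_seq1. Qed.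

Lemma tscalerDr : right_distributive tscale +%R.
Proof.
move=> b t u; have [[s ->] [s' ->]] := (tpi_surj t, tpi_surj u).
by rewrite -tpi_cat !tscale_pi /tscale_seq map_cat tpi_cat.
Qed.

Lemma tscalerDl t : {morph tscale^~ t : a b / a + b}.
Proof.
move=> a b; have [s ->] := tpi_surj t.
by rewrite !tscale_pi tscaleDl_pi tpi_cat.
Qed.

HB.instance Definition _ :=
  GRing.Zmodule_isLmodule.Build B tensor tscalerA tscale1 tscalerDr tscalerDl.

Definition tens : lmodType B := tensor.

Definition tpure (m : M) (x : X) : tens := tpi [:: (m, x)].

Lemma tpureDl m m' x : tpure (m + m') x = tpure m x + tpure m' x.
Proof. by rewrite [RHS](_ : _ = tpi [:: (m, x); (m', x)]) -?tpi_cat //; apply: (tpiP _ _).2; apply: tens_addl. Qed.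

Lemma tpureDr m x x' : tpure m (x + x') = tpure m x + tpure m x'.
Proof. by rewrite [RHS](_ : _ = tpi [:: (m, x); (m, x')]) -?tpi_cat //; apply: (tpiP _ _).2; apply: tens_addr. Qed.

Lemma tpure_bal m a x : tpure (ract m a) x = tpure m (a *: x).
Proof. exact: (tpiP _ _).2 (tens_bal m a x). Qed.

Lemma tpureZl b m x : tpure (b *: m) x = b *: tpure m x.
Proof. by rewrite /tpure [RHS]tscale_pi. Qed.

Lemma tpure0r m : tpure m 0 = 0.
Proof. by apply: (addIr (tpure m 0)); rewrite add0r -tpureDr addr0. Qed.

Lemma tpure0l x : tpure 0 x = 0.
Proof. by rewrite -[X in tpure X](scale0r 0) tpureZl scale0r. Qed.

Lemma tens_ind (P : tens -> Prop) :
  P 0 -> (forall m x, P (tpure m x)) -> (forall t u, P t -> P u -> P (t + u)) ->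
  forall t, P t.
Proof.
move=> P0 P1 PD t; have [s ->] := tpi_surj t; elim: s => [//|[m x] s IH].
by rewrite -cat1s tpi_cat; apply: PD; [exact: P1 | exact: IH].
Qed.

Lemma tens_lin_ext (Y : lmodType B) (f g : {linear tens -> Y}) :
  (forall m x, f (tpure m x) = g (tpure m x)) -> f =1 g.
Proof.
move=> fg; apply: tens_ind => [|//|t u ft fu]; first by rewrite !linear0.
by rewrite !linearD ft fu.
Qed.

Record balanced (Y : lmodType B) (beta : M -> X -> Y) : Prop := Balanced {
  balDl : forall m m' x, beta (m + m') x = beta m x + beta m' x;
  balDr : forall m x x', beta m (x + x') = beta m x + beta m x';
  balA : forall m a x, beta (ract m a) x = beta m (a *: x);
  balZ : forall b m x, beta (b *: m) x = b *: beta m x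
}.

Section Lift.
Variables (Y : lmodType B) (beta : M -> X -> Y) (hb : balanced beta).

Definition tlift_fun (t : tens) : Y := \sum_(p <- repr t) beta p.1 p.2.

Lemma tlift_rel s t : tens_rel s t ->
  \sum_(p <- s) beta p.1 p.2 = \sum_(p <- t) beta p.1 p.2.
Proof.
elim=> {s t} [s|s t _ ->|s t u _ -> _ ->|s s' t t' _ h1 _ h2|s t|x|m m' x|m x x'|m a x] //;
  rewrite ?big_cat /= ?h1 ?h2 //.
- exact: addrC.
- rewrite big_seq1 big_nil /=; apply: (addIr (beta 0 x)).
  by rewrite -(balDl hb) !add0r.
- by rewrite big_seq1 big_cons big_seq1 (balDl hb).
- by rewrite big_seq1 big_cons big_seq1 (balDr hb).
- by rewrite !big_seq1 (balA hb).
Qed.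

Lemma tlift_pi s : tlift_fun (tpi s) = \sum_(p <- s) beta p.1 p.2.
Proof. exact: tlift_rel (repr_rel s). Qed.

Lemma tlift_linear : linear tlift_fun.
Proof.
move=> b t u; have [[s ->] [s' ->]] := (tpi_surj t, tpi_surj u).
rewrite [b *: _]tscale_pi -tpi_cat !tlift_pi big_cat big_map /=; congr (_ + _).
by rewrite scaler_sumr; apply: eq_bigr => p _; rewrite (balZ hb).
Qed.

Definition tlift : {linear tens -> Y} := mk_lin tlift_linear.

Lemma tliftE m x : tlift (tpure m x) = beta m x.
Proof. by rewrite [LHS]tlift_pi big_seq1. Qed.

End Lift.

End Tensor.

Arguments tpure {B A M X}.
Notation "m *t x" := (tpure m x) (at level 40, format "m  *t  x").

(* The functoriality M (x) h of the tensor product in its second argument. *)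
Lemma tmap_bal (B A : pzRingType) (M : bimod B A) (X X' : lmodType A)
  (h : {linear X -> X'}) : balanced (fun (m : M) x => m *t h x).
Proof.
split=> [m m' x|m x x'|m a x|b m x].
- exact: tpureDl.
- by rewrite linearD tpureDr.
- by rewrite linearZ tpure_bal.
- exact: tpureZl.
Qed.

Definition tmap (B A : pzRingType) (M : bimod B A) (X X' : lmodType A)
  (h : {linear X -> X'}) : {linear tens M X -> tens M X'} := tlift (tmap_bal M h).

Lemma tmapE (B A : pzRingType) (M : bimod B A) (X X' : lmodType A)
  (h : {linear X -> X'}) (m : M) x : tmap M h (m *t x) = m *t h x.
Proof. exact: tliftE. Qed.

(* M (x)_A N as a B-C-bimodule, for N an A-C-bimodule. *)
Section TensorBimod.
Variables (B A C : pzRingType) (M : bimod B A) (N : bimod A C).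

Lemma ract_linear c : linear (fun n : N => ract n c).
Proof. by move=> a n n'; rewrite ractDl ractZ. Qed.

Definition tens_ract (t : tens M N) (c : C) : tens M N :=
  tmap M (mk_lin (ract_linear c)) t.

Lemma tens_ractE m n c : tens_ract (m *t n) c = m *t ract n c.
Proof. exact: tmapE. Qed.

Program Definition tens_bimod : bimod B C := @Bimod B C (tens M N) tens_ract _ _ _ _ _.
Next Obligation. by move=> t u c /=; rewrite /tens_ract linearD. Qed.
Next Obligation.
move=> t c c'; elim/tens_ind: t => [|m n|t u IHt IHu].
- by rewrite /tens_ract !linear0 addr0.
- by rewrite !tens_ractE ractDr tpureDr.
- by rewrite /tens_ract !linearD -!/(tens_ract _ _) IHt IHu addrACA.
Qed.
Next Obligation.
move=> t c c'; elim/tens_ind: t => [|m n|t u IHt IHu].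
- by rewrite /tens_ract !linear0.
- by rewrite !tens_ractE ractA.
- by rewrite /tens_ract !linearD -!/(tens_ract _ _) IHt IHu.
Qed.
Next Obligation.
move=> t; elim/tens_ind: t => [|m n|t u IHt IHu].
- by rewrite /tens_ract !linear0.
- by rewrite !tens_ractE ract1.
- by rewrite /tens_ract !linearD -!/(tens_ract _ _) IHt IHu.
Qed.
Next Obligation. by move=> b t c /=; rewrite /tens_ract linearZ. Qed.

End TensorBimod.

Section HomModule.
Variables (A B : pzRingType) (N : bimod A B) (X : lmodType A).

Definition homT := {linear N -> X}.

HB.instance Definition _ := gen_eqMixin homT.
HB.instance Definition _ := gen_choiceMixin homT.

Definition hom0 : homT := \0.
Definition homD (h k : homT) : homT := h \+ k.
Definition homN (h : homT) : homT := \- h.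

Lemma homZ_linear (b : B) (h : homT) : linear (fun n : N => h (ract n b)).
Proof. by move=> a n n'; rewrite ractDl ractZ linearP. Qed.

Definition homZ (b : B) (h : homT) : homT := mk_lin (homZ_linear b h).

Lemma homDA : associative homD.
Proof. by move=> h k l; apply: lin_ext => n /=; rewrite addrA. Qed.
Lemma homDC : commutative homD.
Proof. by move=> h k; apply: lin_ext => n /=; rewrite addrC. Qed.
Lemma hom0D : left_id hom0 homD.
Proof. by move=> h; apply: lin_ext => n /=; rewrite add0r. Qed.
Lemma homND : left_inverse hom0 homN homD.
Proof. by move=> h; apply: lin_ext => n /=; rewrite addNr. Qed.

HB.instance Definition _ := GRing.isZmodule.Build homT homDA homDC hom0D homND.

Lemma homZA a b h : homZ a (homZ b h) = homZ (a * b) h.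
Proof. by apply: lin_ext => n /=; rewrite ractA. Qed.
Lemma homZ1 : left_id 1 homZ.
Proof. by move=> h; apply: lin_ext => n /=; rewrite ract1. Qed.
Lemma homZDr : right_distributive homZ +%R.
Proof. by move=> b h k; apply: lin_ext. Qed.
Lemma homZDl h : {morph homZ^~ h : a b / a + b}.
Proof. by move=> a b; apply: lin_ext => n /=; rewrite ractDr linearD. Qed.

HB.instance Definition _ :=
  GRing.Zmodule_isLmodule.Build B homT homZA homZ1 homZDr homZDl.

Definition hommod : lmodType B := homT.

End HomModule.

Definition hom_fun (A B : pzRingType) (N : bimod A B) (X : lmodType A)
  (h : hommod N X) : {linear N -> X} := h.

Lemma hom_ext (A B : pzRingType) (N : bimod A B) (X : lmodType A)
  (h k : hommod N X) : hom_fun h =1 hom_fun k -> h = k.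
Proof. exact: lin_ext. Qed.

Lemma hom_funZ (A B : pzRingType) (N : bimod A B) (X : lmodType A)
  b (h : hommod N X) n : hom_fun (b *: h) n = hom_fun h (ract n b).
Proof. by []. Qed.

(* The functoriality Hom(N, h). *)
Lemma hmap_linear (A B : pzRingType) (N : bimod A B) (X X' : lmodType A)
  (h : {linear X -> X'}) :
  linear (fun k : hommod N X => (h \o hom_fun k : {linear N -> X'}) : hommod N X').
Proof. by move=> b k l; apply: lin_ext => n /=; rewrite linearD. Qed.

Definition hmap (A B : pzRingType) (N : bimod A B) (X X' : lmodType A)
  (h : {linear X -> X'}) : {linear hommod N X -> hommod N X'} :=
  mk_lin (@hmap_linear A B N X X' h).

(* The adjoint Y -> Hom_A(N, X) of a map N (x)_B Y -> X, and the evaluation *)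
(* map N (x)_B Hom_A(N, X) -> X. *)
Section Adjoint.
Variables (A B : pzRingType) (N : bimod A B).

Section Tilde.
Variables (Y : lmodType B) (X : lmodType A) (g : {linear tens N Y -> X}).

Lemma tilde_fun_linear y : linear (fun n : N => g (n *t y)).
Proof. by move=> a n n'; rewrite tpureDl tpureZl linearP. Qed.

Lemma tilde_linear :
  linear (fun y : Y => mk_lin (tilde_fun_linear y) : hommod N X).
Proof.
by move=> b y y'; apply: lin_ext => n /=; rewrite tpureDr linearD -tpure_bal.
Qed.

Definition tilde : {linear Y -> hommod N X} := mk_lin tilde_linear.

Lemma tildeE y n : hom_fun (tilde y) n = g (n *t y).
Proof. by []. Qed.

End Tilde.

Lemma eval_bal (X : lmodType A) :
  balanced (fun (n : N) (h : hommod N X) => hom_fun h n).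
Proof.
split=> [n n' h|n h h'|n b h|a n h] //; first exact: linearD.
exact: linearZ.
Qed.

Definition evalmod (X : lmodType A) : {linear tens N (hommod N X) -> X} :=
  tlift (eval_bal X).

End Adjoint.

Section KerCoker.
Variables (R : pzRingType) (U V : lmodType R) (f : {linear U -> V}).

Definition in_ker : {pred U} := fun u => f u == 0.

Lemma in_ker_submod : submod_closed in_ker.
Proof.
split=> [|a u v]; rewrite !unfold_in /in_ker; first by rewrite linear0.
by move=> /eqP fu /eqP fv; rewrite linearP fu fv scaler0 addr0.
Qed.

HB.instance Definition _ := GRing.isSubmodClosed.Build R U in_ker in_ker_submod.

Definition kerT := {u : U | u \in in_ker}.
HB.instance Definition _ := SubChoice.on kerT.
HB.instance Definition _ := [SubChoice_isSubLmodule of kerT by <:].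

Definition kermod : lmodType R := kerT.

Definition ker_val : {linear kermod -> U} := (val : kerT -> U).

Lemma ker_valP (k : kermod) : f (ker_val k) = 0.
Proof. exact/eqP/(valP k). Qed.

Lemma ker_val_inj : injective ker_val.
Proof. exact: val_inj. Qed.

Lemma in_kerP u : f u = 0 -> u \in in_ker.
Proof. by move=> fu; apply/eqP. Qed.

Definition ker_sub u (fu : f u = 0) : kermod := Sub u (in_kerP fu).

Lemma ker_subE u (fu : f u = 0) : ker_val (ker_sub fu) = u.
Proof. exact: SubK. Qed.

Definition in_im : {pred V} := fun v => `[< exists u, f u = v >].

Lemma in_imP v : reflect (exists u, f u = v) (v \in in_im).
Proof. exact: asboolP. Qed.

Lemma in_im_zmod : zmod_closed in_im.
Proof.
split=> [|v w]; first by apply/in_imP; exists 0; rewrite linear0.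
by move=> /in_imP[u <-] /in_imP[u' <-]; apply/in_imP; exists (u - u'); rewrite linearB.
Qed.

HB.instance Definition _ := GRing.isZmodClosed.Build V in_im in_im_zmod.

Definition cokerT := Quotient.quot in_im.
HB.instance Definition _ := GRing.Zmodule.on cokerT.

Definition cok (v : V) : cokerT := \pi_cokerT v.

Lemma cok_eq v w : cok v = cok w <-> exists u, f u = v - w.
Proof.
split; first by move/eqP; rewrite piE Quotient.equivE => /in_imP.
by move=> h; apply/eqP; rewrite piE Quotient.equivE; apply/in_imP.
Qed.

Lemma cok_surj (q : cokerT) : exists v, q = cok v.
Proof. by exists (repr q); rewrite /cok reprK. Qed.

Lemma cokD v w : cok (v + w) = cok v + cok w.
Proof. by rewrite /cok !piE. Qed.

Definition cok_scale (a : R) (q : cokerT) : cokerT := cok (a *: repr q).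

Lemma cok_scaleE a v : cok_scale a (cok v) = cok (a *: v).
Proof.
apply/cok_eq; have /cok_eq[u fu] : cok (repr (cok v)) = cok v by rewrite /cok reprK.
by exists (a *: u); rewrite linearZ fu /= scalerBr.
Qed.

Lemma cok_scaleA a b q : cok_scale a (cok_scale b q) = cok_scale (a * b) q.
Proof. by have [v ->] := cok_surj q; rewrite !cok_scaleE scalerA. Qed.
Lemma cok_scale1 : left_id 1 cok_scale.
Proof. by move=> q; have [v ->] := cok_surj q; rewrite !cok_scaleE scale1r. Qed.
Lemma cok_scaleDr : right_distributive cok_scale +%R.
Proof.
move=> a q q'; have [[v ->] [v' ->]] := (cok_surj q, cok_surj q').
by rewrite -cokD !cok_scaleE scalerDr cokD.
Qed.
Lemma cok_scaleDl q : {morph cok_scale^~ q : a b / a + b}.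
Proof.
by move=> a b; have [v ->] := cok_surj q; rewrite !cok_scaleE scalerDl cokD.
Qed.

HB.instance Definition _ :=
  GRing.Zmodule_isLmodule.Build R cokerT cok_scaleA cok_scale1 cok_scaleDr cok_scaleDl.

Definition coker : lmodType R := cokerT.

Lemma cok_linear : linear (cok : V -> coker).
Proof. by move=> a v w; rewrite cokD -cok_scaleE. Qed.

Definition coker_pi : {linear V -> coker} := mk_lin cok_linear.

Lemma coker_surj (q : coker) : exists v, q = coker_pi v.
Proof. exact: cok_surj. Qed.

Lemma coker_pi0 u : coker_pi (f u) = 0.
Proof.
by rewrite -(linear0 coker_pi); apply/cok_eq; exists u; rewrite subr0.
Qed.

Section CokerLift.
Variables (W : lmodType R) (h : {linear V -> W}) (hf : forall u, h (f u) = 0).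

Definition coker_lift_fun (q : coker) : W := h (repr q).

Lemma coker_lift_funE v : coker_lift_fun (coker_pi v) = h v.
Proof.
have /cok_eq[u fu] : cok (repr (cok v)) = cok v by rewrite /cok reprK.
by apply/eqP; rewrite -subr_eq0 -linearB -fu hf.
Qed.

Lemma coker_lift_linear : linear coker_lift_fun.
Proof.
move=> a q q'; have [[v ->] [v' ->]] := (coker_surj q, coker_surj q').
by rewrite -linearP !coker_lift_funE linearP.
Qed.

Definition coker_lift : {linear coker -> W} := mk_lin coker_lift_linear.

Lemma coker_liftE v : coker_lift (coker_pi v) = h v.
Proof. exact: coker_lift_funE. Qed.

End CokerLift.

End KerCoker.

Arguments ker_val {R U V f}.
Arguments ker_valP {R U V f}.

Section QuotientRing.
Variables (B : pzRingType) (U : bimod B B) (phi : bimod_hom U (reg_bimod B)).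

Definition quot_ring : Type := coker phi.
HB.instance Definition _ := GRing.Zmodule.on quot_ring.

Definition qpi (b : B) : quot_ring := coker_pi phi b.

Lemma qpi_surj (q : quot_ring) : exists b, q = qpi b.
Proof. by have [b ->] := coker_surj (q : coker phi); exists b. Qed.

Lemma qpi_eq b c : qpi b = qpi c <-> exists u, (phi u : B) = b - c.
Proof. exact: cok_eq. Qed.

Lemma qpiD b c : qpi (b + c) = qpi b + qpi c.
Proof. exact: cokD. Qed.

Definition qone : quot_ring := qpi 1.
Definition qmul (p q : quot_ring) : quot_ring :=
  qpi ((repr (p : coker phi) : B) * repr (q : coker phi)).

Lemma qmulE b c : qmul (qpi b) (qpi c) = qpi (b * c).
Proof.
set b' : B := repr (qpi b : coker phi); set c' : B := repr (qpi c : coker phi).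
have /qpi_eq[u hu] : qpi b' = qpi b by rewrite /qpi /b' /= /cok reprK.
have /qpi_eq[v hv] : qpi c' = qpi c by rewrite /qpi /c' /= /cok reprK.
apply/qpi_eq; exists (ract u c' + b *: v).
rewrite linearD linearZ bimod_funR /= hu.
rewrite [X in _ + X](_ : _ = b * (phi v : B)) // hv.
by rewrite [X in X + _](_ : _ = (b' - b) * c') // mulrBl mulrBr addrA subrK.
Qed.

Lemma qmulA : associative qmul.
Proof.
move=> p q r; have [[[a ->] [b ->]] [c ->]] := (qpi_surj p, qpi_surj q, qpi_surj r).
by rewrite !qmulE mulrA.
Qed.
Lemma qmul1 : left_id qone qmul.
Proof. by move=> p; have [a ->] := qpi_surj p; rewrite qmulE mul1r. Qed.
Lemma qmulr1 : right_id qone qmul.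
Proof. by move=> p; have [a ->] := qpi_surj p; rewrite qmulE mulr1. Qed.
Lemma qmulDl : left_distributive qmul +%R.
Proof.
move=> p q r; have [[[a ->] [b ->]] [c ->]] := (qpi_surj p, qpi_surj q, qpi_surj r).
by rewrite -qpiD !qmulE mulrDl qpiD.
Qed.
Lemma qmulDr : right_distributive qmul +%R.
Proof.
move=> p q r; have [[[a ->] [b ->]] [c ->]] := (qpi_surj p, qpi_surj q, qpi_surj r).
by rewrite -qpiD !qmulE mulrDr qpiD.
Qed.

HB.instance Definition _ :=
  GRing.Zmodule_isPzRing.Build quot_ring qmulA qmul1 qmulr1 qmulDl qmulDr.

Definition qring : pzRingType := quot_ring.

Lemma qpi_zmod : zmod_morphism (qpi : B -> qring).
Proof. exact: (linearB (coker_pi phi)). Qed.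
Lemma qpi_monoid : monoid_morphism (qpi : B -> qring).
Proof. by split=> // b c; rewrite -qmulE. Qed.

HB.instance Definition _ := GRing.isZmodMorphism.Build B qring qpi qpi_zmod.
HB.instance Definition _ := GRing.isMonoidMorphism.Build B qring qpi qpi_monoid.

Definition qring_pi : {rmorphism B -> qring} := qpi.

Lemma qring_pi_phi u : qring_pi (phi u : B) = 0.
Proof. exact: coker_pi0. Qed.

(* B / Im phi as a (B / Im phi)-B-bimodule. *)
Program Definition qbimod : bimod qring B :=
  @Bimod qring B qring^o (fun q b => (q : qring) * qring_pi b) _ _ _ _ _.
Next Obligation. by move=> p q b /=; rewrite mulrDl. Qed.
Next Obligation. by move=> p a b /=; rewrite rmorphD mulrDr. Qed.
Next Obligation. by move=> p a b /=; rewrite rmorphM mulrA. Qed.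
Next Obligation. by move=> p /=; rewrite rmorph1 mulr1. Qed.
Next Obligation. by move=> c p b /=; rewrite -mulrA. Qed.

End QuotientRing.

Section Restriction.
Variables (S R : pzRingType) (h : {rmorphism S -> R}) (Y : lmodType R).

Definition restrT : Type := Y.
HB.instance Definition _ := GRing.Zmodule.on restrT.

Definition restr_scale (s : S) (y : restrT) : restrT := h s *: (y : Y).

Lemma restrA a b y : restr_scale a (restr_scale b y) = restr_scale (a * b) y.
Proof. by rewrite /restr_scale scalerA rmorphM. Qed.
Lemma restr1 : left_id 1 restr_scale.
Proof. by move=> y; rewrite /restr_scale rmorph1 scale1r. Qed.
Lemma restrDr : right_distributive restr_scale +%R.
Proof. by move=> a y z; rewrite /restr_scale scalerDr. Qed.
Lemma restrDl y : {morph restr_scale^~ y : a b / a + b}.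
Proof. by move=> a b; rewrite /restr_scale rmorphD scalerDl. Qed.

HB.instance Definition _ :=
  GRing.Zmodule_isLmodule.Build S restrT restrA restr1 restrDr restrDl.

Definition restr : lmodType S := restrT.

Lemma restrE s (y : restr) : s *: y = h s *: (y : Y) :> Y.
Proof. by []. Qed.

End Restriction.

Record category := Category {
  ob :> Type;
  hom : ob -> ob -> Type;
  idc : forall X, hom X X;
  compc : forall X Y Z, hom Y Z -> hom X Y -> hom X Z;
  compc1 : forall X Y (f : hom X Y), compc f (idc X) = f;
  comp1c : forall X Y (f : hom X Y), compc (idc Y) f = f;
  compcA : forall X Y Z T (h : hom Z T) (g : hom Y Z) (f : hom X Y),
    compc h (compc g f) = compc (compc h g) f
}.

Arguments hom {c} X Y.
Arguments idc {c} X.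
Arguments compc {c X Y Z} g f.
Notation "g '\c' f" := (compc g f) (at level 40, left associativity).

Section CategoryNotions.
Variable C : category.

Definition monomorphism (X Y : C) (f : hom X Y) : Prop :=
  forall (Z : C) (g h : hom Z X), f \c g = f \c h -> g = h.

Definition epimorphism (X Y : C) (f : hom X Y) : Prop :=
  forall (Z : C) (g h : hom Y Z), g \c f = h \c f -> g = h.

Definition projective_object (P : C) : Prop :=
  forall (X Y : C) (e : hom X Y) (h : hom P Y),
    epimorphism e -> exists k : hom P X, e \c k = h.

Definition is_zero (Z : C) : Prop :=
  (forall X : C, exists! f : hom Z X, True) /\
  (forall X : C, exists! f : hom X Z, True).

Definition isomorphic (X Y : C) : Prop :=
  exists (f : hom X Y) (g : hom Y X), g \c f = idc X /\ f \c g = idc Y.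

End CategoryNotions.

Record functor (C D : category) := Functor {
  fob :> C -> D;
  fmap : forall X Y : C, hom X Y -> hom (fob X) (fob Y);
  fmap1 : forall X, fmap (idc X) = idc (fob X);
  fmapM : forall X Y Z (g : hom Y Z) (f : hom X Y), fmap (g \c f) = fmap g \c fmap f
}.

Arguments fmap {C D} f0 {X Y} f.

Definition functor_comp (C D E : category) (G : functor D E) (F : functor C D) :
  functor C E.
Proof.
refine (@Functor C E (fun X => G (F X)) (fun X Y f => fmap G (fmap F f)) _ _).
- by move=> X; rewrite !fmap1.
- by move=> X Y Z g f; rewrite !fmapM.
Defined.

Definition fully_faithful (C D : category) (F : functor C D) : Prop :=
  forall X Y : C, bijective (fun f : hom X Y => fmap F f).

Definition essentially_surjective (C D : category) (F : functor C D) : Prop :=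
  forall Y : D, exists X : C, isomorphic (F X) Y.

(* [L] is left adjoint to [R], presented by unit, counit and the triangle *)
(* identities. *)
Record adjunction (C D : category) (L : functor C D) (R : functor D C) :=
  Adjunction {
    adj_unit : forall X : C, hom X (R (L X));
    adj_counit : forall Y : D, hom (L (R Y)) Y;
    unit_nat : forall (X X' : C) (f : hom X X'),
      fmap R (fmap L f) \c adj_unit X = adj_unit X' \c f;
    counit_nat : forall (Y Y' : D) (f : hom Y Y'),
      f \c adj_counit Y = adj_counit Y' \c fmap L (fmap R f);
    triangleL : forall X : C, adj_counit (L X) \c fmap L (adj_unit X) = idc (L X);
    triangleR : forall Y : D, fmap R (adj_counit Y) \c adj_unit (R Y) = idc (R Y)
  }.

(* The functors iup, i, ish, jl, j, jr are i^* , i_* , i^! , j_! , j^* , j_* . *)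
(* Additivity is not recorded: adjoint functors between additive categories *)
(* are automatically additive. *)
Record recollement (C' C C'' : category)
    (iup : functor C C') (i : functor C' C) (ish : functor C C')
    (jl : functor C'' C) (j : functor C C'') (jr : functor C'' C) :=
  Recollement {
    rec_iup_i : adjunction iup i;
    rec_i_ish : adjunction i ish;
    rec_jl_j : adjunction jl j;
    rec_j_jr : adjunction j jr;
    rec_i_ff : fully_faithful i;
    rec_jl_ff : fully_faithful jl;
    rec_jr_ff : fully_faithful jr;
    rec_ker : forall X : C, is_zero (j X) <-> exists Y : C', isomorphic (i Y) X
  }.

Definition condition_P (C' C C'' : category)
    (iup : functor C C') (i : functor C' C) (ish : functor C C')
    (jl : functor C'' C) (j : functor C C'') (jr : functor C'' C)
    (r : recollement iup i ish jl j jr) : Prop :=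
  forall P : C, projective_object P -> monomorphism (adj_counit (rec_jl_j r) P).

Definition ModCat (R : pzRingType) : category.
Proof.
refine (@Category (lmodType R) (fun X Y => {linear X -> Y})
          (@id_lin R) (@comp_lin R) _ _ _).
- by move=> X Y f; apply: lin_ext.
- by move=> X Y f; apply: lin_ext.
- by move=> X Y Z T h g f; apply: lin_ext.
Defined.

Lemma bimod_hom_ext (B A : pzRingType) (U V : bimod B A) (f g : bimod_hom U V) :
  f =1 g -> f = g.
Proof.
case: f g => f hf [g hg] /= fg; have {}fg : f = g by apply: lin_ext.
by subst g; rewrite (Prop_irrelevance hf hg).
Qed.

Definition id_bimod (B A : pzRingType) (U : bimod B A) : bimod_hom U U :=
  @BimodHom B A U U (@id_lin B U) (fun _ _ => erefl).

Lemma comp_bimod_subproof (B A : pzRingType) (U V W : bimod B A)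
  (g : bimod_hom V W) (f : bimod_hom U V) u a :
  comp_lin g f (ract u a) = ract (comp_lin g f u) a.
Proof. by rewrite /= !bimod_funR. Qed.

Definition comp_bimod (B A : pzRingType) (U V W : bimod B A)
    (g : bimod_hom V W) (f : bimod_hom U V) : bimod_hom U W :=
  BimodHom (comp_bimod_subproof g f).

Definition BimodCat (B A : pzRingType) : category.
Proof.
refine (@Category (bimod B A) (@bimod_hom B A) (@id_bimod B A) (@comp_bimod B A) _ _ _).
- by move=> X Y f; apply: bimod_hom_ext.
- by move=> X Y f; apply: bimod_hom_ext.
- by move=> X Y Z T h g f; apply: bimod_hom_ext.
Defined.

Lemma is_zero_mod (R : pzRingType) (X : lmodType R) :
  is_zero (X : ModCat R) <-> forall x : X, x = 0.
Proof.
split=> [[hX _] x|X0].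
  have [f [_ fu]] := hX X.
  have e : (id_lin X) = (\0 : {linear X -> X}) by rewrite -(fu (id_lin X) I) -(fu (\0 : {linear X -> X}) I).
  by rewrite -[x]/(id_lin X x) e.
split=> Y.
  exists (\0 : {linear X -> Y}); split=> // f _; apply: lin_ext => x.
  by rewrite (X0 x) !linear0.
exists (\0 : {linear Y -> X}); split=> // f _; apply: lin_ext => x.
by rewrite [LHS]X0 [RHS]X0.
Qed.

(* Primitive projections make swapping the roles of A and B below (see *)
(* [morita_swap] and [Swap]) a definitional involution. *)
#[local] Set Primitive Projections.

(* The data (A, B, M, N, phi, psi) of a Morita ring. *)
Record morita (A B : pzRingType) := Morita {
  bimN : bimod A B;
  bimM : bimod B A;
  phi : bimod_hom (tens_bimod bimM bimN) (reg_bimod B);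
  psi : bimod_hom (tens_bimod bimN bimM) (reg_bimod A);
  phi_psi : forall (m m' : bimM) (n : bimN),
    ract m' (psi (n *t m)) = (phi (m' *t n) : B) *: m;
  psi_phi : forall (m : bimM) (n n' : bimN),
    ract n' (phi (m *t n)) = (psi (n' *t m) : A) *: n
}.

Section MoritaRing.
Variables (A B : pzRingType) (C : morita A B).
Local Notation M := (bimM C).
Local Notation N := (bimN C).

(* The matrix [a n; m b]. *)
Record matT := Mat { mat11 : A; mat12 : N; mat21 : M; mat22 : B }.

HB.instance Definition _ := gen_eqMixin matT.
HB.instance Definition _ := gen_choiceMixin matT.

Definition mat_zero := Mat 0 0 0 0.
Definition mat_add (u v : matT) := Mat (mat11 u + mat11 v) (mat12 u + mat12 v)
  (mat21 u + mat21 v) (mat22 u + mat22 v).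
Definition mat_opp (u : matT) :=
  Mat (- mat11 u) (- mat12 u) (- mat21 u) (- mat22 u).
Definition mat_one := Mat 1 0 0 1.
Definition mat_mul (u v : matT) := Mat
  (mat11 u * mat11 v + psi C (mat12 u *t mat21 v))
  (mat11 u *: mat12 v + ract (mat12 u) (mat22 v))
  (ract (mat21 u) (mat11 v) + mat22 u *: mat21 v)
  (phi C (mat21 u *t mat12 v) + mat22 u * mat22 v).

Lemma mat_addA : associative mat_add.
Proof. by move=> u v w; rewrite /mat_add /= !addrA. Qed.
Lemma mat_addC : commutative mat_add.
Proof.
move=> u v; rewrite /mat_add addrC [mat12 u + _]addrC [mat21 u + _]addrC.
by rewrite [mat22 u + _]addrC.
Qed.
Lemma mat_add0 : left_id mat_zero mat_add.
Proof. by case=> a n m b; rewrite /mat_add /= !add0r. Qed.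
Lemma mat_addN : left_inverse mat_zero mat_opp mat_add.
Proof. by case=> a n m b; rewrite /mat_add /= !addNr. Qed.

HB.instance Definition _ := GRing.isZmodule.Build matT mat_addA mat_addC mat_add0 mat_addN.

Lemma ract0l (B' A' : pzRingType) (V : bimod B' A') a : ract (0 : V) a = 0.
Proof. by apply: (addIr (ract (0 : V) a)); rewrite -ractDl !add0r. Qed.
Lemma ract0r (B' A' : pzRingType) (V : bimod B' A') (v : V) : ract v 0 = 0.
Proof. by apply: (addIr (ract v 0)); rewrite -ractDr !add0r. Qed.

Lemma psiZ a (n : N) (m : M) : (psi C ((a *: n) *t m) : A) = a * psi C (n *t m).
Proof. by rewrite tpureZl linearZ. Qed.
Lemma phiZ b (m : M) (n : N) : (phi C ((b *: m) *t n) : B) = b * phi C (m *t n).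
Proof. by rewrite tpureZl linearZ. Qed.
Lemma psiR (n : N) (m : M) a : (psi C (n *t ract m a) : A) = (psi C (n *t m) : A) * a.
Proof. by rewrite -[RHS]bimod_funR /= tens_ractE. Qed.
Lemma phiR (m : M) (n : N) b : (phi C (m *t ract n b) : B) = (phi C (m *t n) : B) * b.
Proof. by rewrite -[RHS]bimod_funR /= tens_ractE. Qed.

Lemma mat_mulA : associative mat_mul.
Proof.
case=> a n m b [a' n' m' b'] [a'' n'' m'' b'']; rewrite /mat_mul /=; congr Mat.
- rewrite tpureDl tpureDr !linearD /= psiZ psiR -(tpure_bal n b' m'').
  by rewrite mulrDr mulrDl mulrA -!addrA; congr (_ + _); rewrite addrCA.
- rewrite ractDl ractDr scalerDr scalerDl scalerA ractZ !ractA psi_phi -!addrA.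
  by congr (_ + _); rewrite addrCA.
- rewrite ractDl ractDr scalerDr scalerDl scalerA ractZ !ractA phi_psi -!addrA.
  by congr (_ + _); rewrite addrCA.
- rewrite tpureDl tpureDr !linearD /= phiZ phiR -(tpure_bal m a' n'').
  by rewrite mulrDr mulrDl mulrA -!addrA; congr (_ + _); rewrite addrCA.
Qed.
Lemma mat_mul1 : left_id mat_one mat_mul.
Proof.
case=> a n m b; rewrite /mat_mul /= !tpure0l !linear0 !ract0l !scale1r !mul1r.
by rewrite !add0r !addr0.
Qed.
Lemma mat_mulr1 : right_id mat_one mat_mul.
Proof.
case=> a n m b; rewrite /mat_mul /= !tpure0r !linear0 !scaler0 !ract1 !mulr1.
by rewrite !add0r !addr0.
Qed.
Lemma mat_mulDl : left_distributive mat_mul +%R.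
Proof.
case=> a n m b [a' n' m' b'] [a'' n'' m'' b'']; congr Mat => /=.
- by rewrite tpureDl linearD mulrDl addrACA.
- by rewrite scalerDl ractDl addrACA.
- by rewrite scalerDl ractDl addrACA.
- by rewrite tpureDl linearD mulrDl addrACA.
Qed.
Lemma mat_mulDr : right_distributive mat_mul +%R.
Proof.
case=> a n m b [a' n' m' b'] [a'' n'' m'' b'']; congr Mat => /=.
- by rewrite tpureDr linearD mulrDr addrACA.
- by rewrite scalerDr ractDr addrACA.
- by rewrite scalerDr ractDr addrACA.
- by rewrite tpureDr linearD mulrDr addrACA.
Qed.

HB.instance Definition _ :=
  GRing.Zmodule_isPzRing.Build matT mat_mulA mat_mul1 mat_mulr1 mat_mulDl mat_mulDr.

Definition morita_ring : pzRingType := matT.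

(* The quadruple (X, Y)_{f,g}. *)
Record quad := Quad {
  qX : lmodType A;
  qY : lmodType B;
  qf : {linear tens M qX -> qY};
  qg : {linear tens N qY -> qX};
  qgf : forall (n : N) (m : M) (x : qX),
    qg (n *t qf (m *t x)) = (psi C (n *t m) : A) *: x;
  qfg : forall (m : M) (n : N) (y : qY),
    qf (m *t qg (n *t y)) = (phi C (m *t n) : B) *: y
}.

Record quad_hom (p q : quad) := QuadHom {
  qa : {linear qX p -> qX q};
  qb : {linear qY p -> qY q};
  qaf : forall t, qb (qf p t) = qf q (tmap M qa t);
  qbg : forall t, qa (qg p t) = qg q (tmap N qb t)
}.

Lemma quad_hom_ext (p q : quad) (h k : quad_hom p q) :
  qa h =1 qa k -> qb h =1 qb k -> h = k.
Proof.
case: h k => a b h1 h2 [a' b' h1' h2'] /= /lin_ext ea /lin_ext eb.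
by subst a' b'; rewrite (Prop_irrelevance h1 h1') (Prop_irrelevance h2 h2').
Qed.

Lemma quad_id1 (q : quad) t : id_lin (qY q) (qf q t) = qf q (tmap M (id_lin (qX q)) t).
Proof.
move: t; apply: (tens_lin_ext (f := comp_lin (id_lin (qY q)) (qf q))
  (g := comp_lin (qf q) (tmap M (id_lin (qX q))))) => m x.
by rewrite !comp_linE tmapE !id_linE.
Qed.

Lemma quad_id2 (q : quad) t : id_lin (qX q) (qg q t) = qg q (tmap N (id_lin (qY q)) t).
Proof.
move: t; apply: (tens_lin_ext (f := comp_lin (id_lin (qX q)) (qg q))
  (g := comp_lin (qg q) (tmap N (id_lin (qY q))))) => m x.
by rewrite !comp_linE tmapE !id_linE.
Qed.

Definition quad_id (q : quad) : quad_hom q q := QuadHom (@quad_id1 q) (@quad_id2 q).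

Lemma tmap_comp (R S : pzRingType) (V : bimod R S) (X Y Z : lmodType S)
  (g : {linear Y -> Z}) (f : {linear X -> Y}) t :
  tmap V (comp_lin g f) t = tmap V g (tmap V f t).
Proof.
move: t; apply: (tens_lin_ext (f := tmap V (comp_lin g f))
  (g := comp_lin (tmap V g) (tmap V f))) => v x.
by rewrite !comp_linE !tmapE.
Qed.

Lemma quad_comp1 (p q r : quad) (h : quad_hom q r) (k : quad_hom p q) t :
  comp_lin (qb h) (qb k) (qf p t) = qf r (tmap M (comp_lin (qa h) (qa k)) t).
Proof. by rewrite tmap_comp !comp_linE !qaf. Qed.

Lemma quad_comp2 (p q r : quad) (h : quad_hom q r) (k : quad_hom p q) t :
  comp_lin (qa h) (qa k) (qg p t) = qg r (tmap N (comp_lin (qb h) (qb k)) t).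
Proof. by rewrite tmap_comp !comp_linE !qbg. Qed.

Definition quad_comp (p q r : quad) (h : quad_hom q r) (k : quad_hom p q) :
  quad_hom p r := QuadHom (quad_comp1 h k) (quad_comp2 h k).

(* Lambda-Mod, in terms of quadruples; [quad_module_equivalence] below shows *)
(* that it is equivalent to [ModCat morita_ring]. *)
Definition QuadCat : category.
Proof.
refine (@Category quad quad_hom quad_id quad_comp _ _ _).
- by move=> p q h; apply: quad_hom_ext.
- by move=> p q h; apply: quad_hom_ext.
- by move=> p q r s h k l; apply: quad_hom_ext.
Defined.

End MoritaRing.

#[local] Unset Primitive Projections.

Section QuotientModules.
Variables (B : pzRingType) (U : bimod B B) (phi : bimod_hom U (reg_bimod B)).
Local Notation Q := (qring phi).
Local Notation pi := (qring_pi phi).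

(* The identity of the bimodule B / Im phi. *)
Definition qb1 : qbimod phi := (1 : Q).

Lemma qb_pure (K : lmodType B) (p : Q) (k : K) :
  (p : qbimod phi) *t k = p *: (qb1 *t k).
Proof. by rewrite -tpureZl /qb1 /=; congr tpure; rewrite [RHS]mulr1. Qed.

Lemma pi_pure (K : lmodType B) b (k : K) : pi b *: (qb1 *t k) = qb1 *t (b *: k).
Proof. by rewrite -tpure_bal -qb_pure; congr tpure; rewrite [RHS]mul1r. Qed.

(* The map K -> B / Im phi (x) K, k |-> 1 (x) k. *)
Lemma qin_linear (K : lmodType B) :
  linear (fun k : K => qb1 *t k : restr pi (tens (qbimod phi) K)).
Proof. by move=> b k l; rewrite tpureDr -pi_pure. Qed.

Definition qin (K : lmodType B) : {linear K -> restr pi (tens (qbimod phi) K)} :=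
  mk_lin (@qin_linear K).

Lemma qtens_ext (K : lmodType B) (Y : lmodType Q)
    (f g : {linear tens (qbimod phi) K -> Y}) :
  (forall k, f (qb1 *t k) = g (qb1 *t k)) -> f = g.
Proof.
move=> fg; apply/lin_ext/tens_lin_ext => p k.
by rewrite qb_pure !linearZ fg.
Qed.

Lemma qext_bal (K : lmodType B) (Y : lmodType Q) (h : {linear K -> restr pi Y}) :
  balanced (fun (p : qbimod phi) (k : K) => (p : Q) *: (h k : Y)).
Proof.
split=> [p q k|p k l|p b k|q p k].
- by rewrite scalerDl.
- by rewrite linearD scalerDr.
- by rewrite linearZ /= restrE scalerA.
- by rewrite scalerA.
Qed.

Definition qext (K : lmodType B) (Y : lmodType Q) (h : {linear K -> restr pi Y}) :
  {linear tens (qbimod phi) K -> Y} := tlift (qext_bal h).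

Lemma qextE (K : lmodType B) (Y : lmodType Q) (h : {linear K -> restr pi Y}) k :
  qext h (qb1 *t k) = h k.
Proof. by rewrite tliftE [LHS]scale1r. Qed.

Lemma restr_lin_subproof (Y Y' : lmodType Q) (h : {linear Y -> Y'}) :
  linear (h : restr pi Y -> restr pi Y').
Proof. by move=> b y z; rewrite restrE linearP. Qed.

Definition restr_lin (Y Y' : lmodType Q) (h : {linear Y -> Y'}) :
  {linear restr pi Y -> restr pi Y'} := mk_lin (restr_lin_subproof h).

Lemma unrestr_linear (Y Y' : lmodType Q) (h : {linear restr pi Y -> restr pi Y'}) :
  linear (h : Y -> Y').
Proof.
move=> q y z; have [b ->] := qpi_surj q.
exact: (linearP h b y z).
Qed.

Definition unrestr (Y Y' : lmodType Q) (h : {linear restr pi Y -> restr pi Y'}) :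
  {linear Y -> Y'} := mk_lin (unrestr_linear h).

(* A B-module annihilated by Im phi, as a (B / Im phi)-module. *)
Section Annihilated.
Variables (V : lmodType B) (hV : forall u (v : V), (phi u : B) *: v = 0).

Definition annT : Type := V.
HB.instance Definition _ := GRing.Zmodule.on annT.

Definition ann_scale (q : Q) (v : annT) : annT :=
  (repr (q : coker phi) : B) *: (v : V).

Lemma ann_scaleE b v : ann_scale (pi b) v = b *: (v : V).
Proof.
rewrite /ann_scale; set c : B := repr _.
have /qpi_eq[u hu] : qpi phi c = qpi phi b by rewrite /qpi /c /= /cok reprK.
by apply/eqP; rewrite -subr_eq0 -scalerBl -hu hV.
Qed.

Lemma annA p q v : ann_scale p (ann_scale q v) = ann_scale (p * q) v.
Proof.
have [[a ->] [b ->]] := (qpi_surj p, qpi_surj q).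
by rewrite -!/(pi _) -rmorphM !ann_scaleE scalerA.
Qed.
Lemma ann1 : left_id 1 ann_scale.
Proof. by move=> v; rewrite -(rmorph1 pi) ann_scaleE scale1r. Qed.
Lemma annDr : right_distributive ann_scale +%R.
Proof. by move=> p v w; rewrite /ann_scale scalerDr. Qed.
Lemma annDl v : {morph ann_scale^~ v : p q / p + q}.
Proof.
move=> p q; have [[a ->] [b ->]] := (qpi_surj p, qpi_surj q).
by rewrite -!/(pi _) -rmorphD !ann_scaleE scalerDl.
Qed.

HB.instance Definition _ := GRing.Zmodule_isLmodule.Build Q annT annA ann1 annDr annDl.

Definition ann_mod : lmodType Q := annT.

Lemma ann_in_linear : linear (fun v : V => v : restr pi ann_mod).
Proof. by move=> b v w; rewrite restrE [_ *: (v : ann_mod)]ann_scaleE. Qed.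
Lemma ann_out_linear : linear (fun v : restr pi ann_mod => v : V).
Proof. by move=> b v w; rewrite restrE [_ *: (v : ann_mod)]ann_scaleE. Qed.

Definition ann_in : {linear V -> restr pi ann_mod} := mk_lin ann_in_linear.
Definition ann_out : {linear restr pi ann_mod -> V} := mk_lin ann_out_linear.

(* B / Im phi (x) V -> V, pi b (x) v |-> b v. *)
Definition ann_eval : {linear restr pi (tens (qbimod phi) V) -> V} :=
  comp_lin ann_out (restr_lin (qext ann_in)).

Lemma ann_evalE v : ann_eval (qb1 *t v) = v.
Proof. exact: (qextE ann_in v). Qed.

End Annihilated.

Lemma restr_ann (Y : lmodType Q) u (y : restr pi Y) : (phi u : B) *: y = 0.
Proof. by rewrite restrE qring_pi_phi scale0r. Qed.

End QuotientModules.

Section KerCokerMaps.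
Variables (R : pzRingType) (U V U' V' : lmodType R).
Variables (f : {linear U -> V}) (f' : {linear U' -> V'}).

Lemma coker_map_subproof (a : U -> U') (b : {linear V -> V'})
  (h : forall u, b (f u) = f' (a u)) u : comp_lin (coker_pi f') b (f u) = 0.
Proof. by rewrite comp_linE h coker_pi0. Qed.

Definition coker_map (a : U -> U') (b : {linear V -> V'})
    (h : forall u, b (f u) = f' (a u)) : {linear coker f -> coker f'} :=
  coker_lift (coker_map_subproof h).

Lemma coker_mapE a b h v : @coker_map a b h (coker_pi f v) = coker_pi f' (b v).
Proof. exact: coker_liftE. Qed.

Lemma ker_map_subproof (a : {linear U -> U'})
  (h : forall u, f u = 0 -> f' (a u) = 0) (k : kermod f) : f' (a (ker_val k)) = 0.
Proof. exact/h/ker_valP. Qed.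

Lemma ker_map_linear (a : {linear U -> U'}) (h : forall u, f u = 0 -> f' (a u) = 0) :
  linear (fun k : kermod f => ker_sub (ker_map_subproof h k)).
Proof.
by move=> r k l; apply: ker_val_inj; rewrite [RHS]linearP !ker_subE !linearP.
Qed.

Definition ker_map (a : {linear U -> U'}) (h : forall u, f u = 0 -> f' (a u) = 0) :
  {linear kermod f -> kermod f'} := mk_lin (ker_map_linear h).

Lemma ker_mapE a h k : ker_val (@ker_map a h k) = a (ker_val k).
Proof. exact: ker_subE. Qed.

End KerCokerMaps.

Section First.
Variables (A B : pzRingType) (C : morita A B).
Local Notation M := (bimM C).
Local Notation N := (bimN C).
Local Notation phi := (phi C).
Local Notation psi := (psi C).
Local Notation Q := (qring phi).
Local Notation pi := (qring_pi phi).

Definition zero_mod (R : pzRingType) : lmodType R := 'rV[R]_0.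

Lemma zero_modP (R : pzRingType) (x : zero_mod R) : x = 0.
Proof. exact: thinmx0. Qed.

(* Psi_X and its adjoint M (x) X -> Hom_A(N, X). *)
Section PsiMap.
Variable X : lmodType A.

Lemma Psi_inner_linear (m : M) (x : X) :
  linear (fun n : N => (psi (n *t m) : A) *: x).
Proof.
move=> a n n'; rewrite tpureDl tpureZl linearP /= scalerDl scalerA; congr (_ + _).
Qed.

Lemma Psi_bal : balanced (fun (m : M) (x : X) =>
  mk_lin (Psi_inner_linear m x) : hommod N X).
Proof.
split=> [m m' x|m x x'|m a x|b m x]; apply: lin_ext => n /=.
- by rewrite tpureDr linearD scalerDl.
- by rewrite scalerDr.
- by rewrite psiR scalerA.
- by rewrite tpure_bal.
Qed.

Definition Psi_tilde : {linear tens M X -> hommod N X} := tlift Psi_bal.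

Lemma Psi_tildeE m x n : hom_fun (Psi_tilde (m *t x)) n = (psi (n *t m) : A) *: x.
Proof. by rewrite tliftE. Qed.

Definition Psi : {linear tens N (tens M X) -> X} :=
  comp_lin (evalmod N X) (tmap N Psi_tilde).

Lemma PsiE n m x : Psi (n *t (m *t x)) = (psi (n *t m) : A) *: x.
Proof. by rewrite comp_linE tmapE tliftE Psi_tildeE. Qed.

Lemma Psi_homE n t : Psi (n *t t) = hom_fun (Psi_tilde t) n.
Proof. by rewrite comp_linE tmapE tliftE. Qed.

Lemma tilde_Psi : tilde Psi = Psi_tilde.
Proof. by apply: lin_ext => t; apply: lin_ext => n; rewrite -Psi_homE. Qed.

End PsiMap.

Definition U_A : functor (QuadCat C) (ModCat A).
Proof.
by refine (@Functor (QuadCat C) (ModCat A) (@qX A B C) (fun p q h => qa h) _ _).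
Defined.

Lemma T_A_qgf (X : lmodType A) (n : N) (m : M) (x : X) :
  Psi X (n *t id_lin (tens M X) (m *t x)) = (psi (n *t m) : A) *: x.
Proof. exact: PsiE. Qed.

Lemma T_A_qfg (X : lmodType A) (m : M) (n : N) (y : tens M X) :
  id_lin (tens M X) (m *t Psi X (n *t y)) = (phi (m *t n) : B) *: y.
Proof.
rewrite id_linE; elim/tens_ind: y => [|m' x|t u IHt IHu].
- by rewrite tpure0r linear0 tpure0r scaler0.
- by rewrite PsiE -tpure_bal phi_psi tpureZl.
- by rewrite tpureDr linearD tpureDr IHt IHu scalerDr.
Qed.

Definition T_A_ob (X : lmodType A) : quad C :=
  @Quad A B C X (tens M X) (id_lin (tens M X)) (Psi X) (@T_A_qgf X) (@T_A_qfg X).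

Lemma Psi_nat (X X' : lmodType A) (h : {linear X -> X'}) t :
  h (Psi X t) = Psi X' (tmap N (tmap M h) t).
Proof.
elim/tens_ind: t => [|n t|t u IHt IHu]; last by rewrite !linearD IHt IHu.
  by rewrite !linear0.
elim/tens_ind: t => [|m x|t u IHt IHu].
- by rewrite tpure0r !linear0.
- by rewrite PsiE !tmapE PsiE linearZ.
- by rewrite tpureDr !linearD IHt IHu.
Qed.

Definition T_A_hom (X X' : lmodType A) (h : {linear X -> X'}) :
    quad_hom (T_A_ob X) (T_A_ob X') :=
  @QuadHom A B C (T_A_ob X) (T_A_ob X') h (tmap M h) (fun _ => erefl) (Psi_nat h).

Lemma tmap_id (R S : pzRingType) (V : bimod R S) (X : lmodType S) t :
  tmap V (id_lin X) t = t.
Proof.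
move: t; apply: (tens_lin_ext (f := tmap V (id_lin X)) (g := id_lin _)) => v x.
by rewrite tmapE.
Qed.

Definition T_A : functor (ModCat A) (QuadCat C).
Proof.
refine (@Functor (ModCat A) (QuadCat C) T_A_ob T_A_hom _ _).
- by move=> X; apply: quad_hom_ext => // t; apply: tmap_id.
- by move=> X Y Z g f; apply: quad_hom_ext => // t; apply: tmap_comp.
Defined.

Lemma H_A_qgf (X : lmodType A) (n : N) (m : M) (x : X) :
  evalmod N X (n *t tilde (Psi X) (m *t x)) = (psi (n *t m) : A) *: x.
Proof. by rewrite tliftE tildeE PsiE. Qed.

Lemma H_A_qfg (X : lmodType A) (m : M) (n : N) (y : hommod N X) :
  tilde (Psi X) (m *t evalmod N X (n *t y)) = (phi (m *t n) : B) *: y.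
Proof.
apply: hom_ext => n'; rewrite tildeE PsiE tliftE.
by rewrite hom_funZ psi_phi linearZ.
Qed.

Definition H_A_ob (X : lmodType A) : quad C :=
  @Quad A B C X (hommod N X) (tilde (Psi X)) (evalmod N X) (@H_A_qgf X) (@H_A_qfg X).

Lemma hmapE (X X' : lmodType A) (h : {linear X -> X'}) (k : hommod N X) n :
  hom_fun (hmap N h k) n = h (hom_fun k n).
Proof. by []. Qed.

Lemma H_A_hom1 (X X' : lmodType A) (h : {linear X -> X'}) t :
  hmap N h (tilde (Psi X) t) = tilde (Psi X') (tmap M h t).
Proof.
by apply: hom_ext => n; rewrite hmapE !tildeE Psi_nat tmapE.
Qed.

Lemma H_A_hom2 (X X' : lmodType A) (h : {linear X -> X'}) t :
  h (evalmod N X t) = evalmod N X' (tmap N (hmap N h) t).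
Proof.
elim/tens_ind: t => [|n k|t u IHt IHu]; last by rewrite !linearD IHt IHu.
  by rewrite !linear0.
by rewrite tmapE !tliftE hmapE.
Qed.

Definition H_A_hom (X X' : lmodType A) (h : {linear X -> X'}) :
    quad_hom (H_A_ob X) (H_A_ob X') :=
  @QuadHom A B C (H_A_ob X) (H_A_ob X') h (hmap N h) (H_A_hom1 h) (H_A_hom2 h).

Definition H_A : functor (ModCat A) (QuadCat C).
Proof.
refine (@Functor (ModCat A) (QuadCat C) H_A_ob H_A_hom _ _).
- by move=> X; apply: quad_hom_ext => // t; apply: lin_ext.
- by move=> X Y Z g f; apply: quad_hom_ext => // t; apply: lin_ext.
Defined.

Lemma Z_B_qgf (Y : lmodType Q) (n : N) (m : M) (x : zero_mod A) :
  (\0 : {linear tens N (restr pi Y) -> zero_mod A})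
     (n *t (\0 : {linear tens M (zero_mod A) -> restr pi Y}) (m *t x))
  = (psi (n *t m) : A) *: x.
Proof. by rewrite [x]zero_modP scaler0. Qed.

Lemma Z_B_qfg (Y : lmodType Q) (m : M) (n : N) (y : restr pi Y) :
  (\0 : {linear tens M (zero_mod A) -> restr pi Y})
     (m *t (\0 : {linear tens N (restr pi Y) -> zero_mod A}) (n *t y))
  = (phi (m *t n) : B) *: y.
Proof. by rewrite restr_ann. Qed.

Definition Z_B_ob (Y : lmodType Q) : quad C :=
  @Quad A B C (zero_mod A) (restr pi Y) \0 \0 (@Z_B_qgf Y) (@Z_B_qfg Y).

Lemma Z_B_hom1 (Y Y' : lmodType Q) (h : {linear Y -> Y'}) t :
  restr_lin h (qf (Z_B_ob Y) t) = qf (Z_B_ob Y') (tmap M (id_lin (zero_mod A)) t).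
Proof. exact: linear0 (restr_lin h). Qed.

Definition Z_B_hom (Y Y' : lmodType Q) (h : {linear Y -> Y'}) :
    quad_hom (Z_B_ob Y) (Z_B_ob Y') :=
  @QuadHom A B C (Z_B_ob Y) (Z_B_ob Y') (id_lin (zero_mod A)) (restr_lin h)
    (Z_B_hom1 h) (fun _ => erefl).

Definition Z_B : functor (ModCat Q) (QuadCat C).
Proof.
refine (@Functor (ModCat Q) (QuadCat C) Z_B_ob Z_B_hom _ _).
- by move=> X; apply: quad_hom_ext.
- by move=> X Y Z g f; apply: quad_hom_ext.
Defined.

Definition Q_B_ob (q : quad C) : lmodType Q := tens (qbimod phi) (coker (qf q)).

Definition Q_B_hom (p q : quad C) (h : quad_hom p q) :
  {linear Q_B_ob p -> Q_B_ob q} := tmap (qbimod phi) (coker_map (@qaf A B C p q h)).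

Definition Q_B : functor (QuadCat C) (ModCat Q).
Proof.
refine (@Functor (QuadCat C) (ModCat Q) Q_B_ob Q_B_hom _ _).
- move=> q; apply: qtens_ext => k; rewrite tmapE; congr tpure.
  by have [y ->] := coker_surj k; rewrite coker_mapE.
- move=> p q r g f; apply: qtens_ext => k; rewrite [RHS]comp_linE !tmapE; congr tpure.
  by have [y ->] := coker_surj k; rewrite !coker_mapE.
Defined.

Definition P_B_ob (q : quad C) : lmodType Q :=
  tens (qbimod phi) (kermod (tilde (qg q))).

Lemma ker_tildeP (q : quad C) (y : qY q) :
  tilde (qg q) y = 0 <-> forall n, qg q (n *t y) = 0.
Proof.
split=> [h n|h]; first by rewrite -tildeE h.
by apply: hom_ext => n; rewrite tildeE h.
Qed.

Lemma P_B_hom_subproof (p q : quad C) (h : quad_hom p q) y :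
  tilde (qg p) y = 0 -> tilde (qg q) (qb h y) = 0.
Proof.
move/ker_tildeP => hy; apply/ker_tildeP => n.
by rewrite -tmapE -qbg hy linear0.
Qed.

Definition P_B_hom (p q : quad C) (h : quad_hom p q) :
    {linear P_B_ob p -> P_B_ob q} :=
  tmap (qbimod phi) (ker_map (@P_B_hom_subproof p q h)).

Definition P_B : functor (QuadCat C) (ModCat Q).
Proof.
refine (@Functor (QuadCat C) (ModCat Q) P_B_ob P_B_hom _ _).
- move=> q; apply: qtens_ext => k; rewrite tmapE; congr tpure.
  exact: ker_val_inj.
- move=> p q r g f; apply: qtens_ext => k; rewrite [RHS]comp_linE !tmapE; congr tpure.
  exact: ker_val_inj.
Defined.

(* (T_A, U_A), with counit (1, f) : T_A X -> (X, Y)_{f,g} *)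
Lemma TU_counit1 (q : quad C) t :
  qf q (qf (T_A_ob (qX q)) t) = qf q (tmap M (id_lin (qX q)) t).
Proof. by rewrite tmap_id. Qed.

Lemma TU_counit2 (q : quad C) t :
  id_lin (qX q) (qg (T_A_ob (qX q)) t) = qg q (tmap N (qf q) t).
Proof.
elim/tens_ind: t => [|n t|t u IHt IHu]; last by rewrite !linearD -IHt -IHu.
  by rewrite !linear0.
elim/tens_ind: t => [|m x|t u IHt IHu].
- by rewrite tpure0r !linear0.
- by rewrite tmapE qgf id_linE [LHS]PsiE.
- by rewrite tpureDr !linearD -IHt -IHu.
Qed.

Definition TU_counit (q : quad C) : quad_hom (T_A_ob (qX q)) q :=
  @QuadHom A B C (T_A_ob (qX q)) q (id_lin (qX q)) (qf q)
    (@TU_counit1 q) (@TU_counit2 q).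

Definition adj_T_U : adjunction T_A U_A.
Proof.
refine (@Adjunction (ModCat A) (QuadCat C) T_A U_A
          (fun X => id_lin X) TU_counit _ _ _ _).
- by move=> X X' f; apply: lin_ext.
- by move=> p q h; apply: quad_hom_ext => // t; apply: qaf.
- by move=> X; apply: quad_hom_ext => // t; apply: tmap_id.
- by move=> q; apply: lin_ext.
Defined.

(* (U_A, H_A), with unit (1, tilde g) *)
Lemma UH_unit1 (q : quad C) t :
  tilde (qg q) (qf q t) = qf (H_A_ob (qX q)) (tmap M (id_lin (qX q)) t).
Proof.
rewrite tmap_id; elim/tens_ind: t => [|m x|t u IHt IHu].
- by rewrite !linear0.
- by apply: hom_ext => n; rewrite !tildeE qgf PsiE.
- by rewrite !linearD IHt IHu.
Qed.

Lemma UH_unit2 (q : quad C) t :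
  id_lin (qX q) (qg q t) = qg (H_A_ob (qX q)) (tmap N (tilde (qg q)) t).
Proof.
elim/tens_ind: t => [|n y|t u IHt IHu]; last by rewrite !linearD -IHt -IHu.
  by rewrite !linear0.
by rewrite tmapE [RHS]tliftE.
Qed.

Definition UH_unit (q : quad C) : quad_hom q (H_A_ob (qX q)) :=
  @QuadHom A B C q (H_A_ob (qX q)) (id_lin (qX q)) (tilde (qg q))
    (@UH_unit1 q) (@UH_unit2 q).

Definition adj_U_H : adjunction U_A H_A.
Proof.
refine (@Adjunction (QuadCat C) (ModCat A) U_A H_A
          UH_unit (fun X => id_lin X) _ _ _ _).
- move=> p q h; apply: quad_hom_ext => // y; apply: hom_ext => n.
  by rewrite [LHS]qbg tmapE.
- by move=> X X' f; apply: lin_ext.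
- by move=> q; apply: lin_ext.
- move=> X; apply: quad_hom_ext => // y; apply: hom_ext => n.
  exact: (tliftE (eval_bal N X) n (y : hommod N X)).
Defined.

Definition zero_lin (R : pzRingType) (U V : lmodType R) : {linear U -> V} := \0.

Definition QZ_unitY (q : quad C) : {linear qY q -> restr pi (Q_B_ob q)} :=
  comp_lin (qin phi (coker (qf q))) (coker_pi (qf q)).

Lemma QZ_unit1 (q : quad C) t :
  QZ_unitY q (qf q t)
  = qf (Z_B_ob (Q_B_ob q)) (tmap M (zero_lin (qX q) (zero_mod A)) t).
Proof. by rewrite comp_linE coker_pi0 linear0. Qed.

Definition QZ_unit (q : quad C) : quad_hom q (Z_B_ob (Q_B_ob q)) :=
  @QuadHom A B C q (Z_B_ob (Q_B_ob q)) (zero_lin (qX q) (zero_mod A)) (QZ_unitY q)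
    (@QZ_unit1 q) (fun _ => erefl).

Lemma QZ_counit_subproof (Y : lmodType Q) t :
  id_lin (restr pi Y) (qf (Z_B_ob Y) t) = 0.
Proof. by []. Qed.

Definition QZ_counit (Y : lmodType Q) : {linear Q_B_ob (Z_B_ob Y) -> Y} :=
  qext (coker_lift (@QZ_counit_subproof Y)).

Definition adj_Q_Z : adjunction Q_B Z_B.
Proof.
refine (@Adjunction (QuadCat C) (ModCat Q) Q_B Z_B QZ_unit QZ_counit _ _ _ _).
- move=> p q h; apply: quad_hom_ext => [x|y]; first by rewrite [LHS]zero_modP [RHS]zero_modP.
  by rewrite [LHS]tmapE coker_mapE.
- move=> Y Y' f; apply: qtens_ext => k; have [y ->] := coker_surj k.
  by rewrite [LHS]comp_linE [RHS]comp_linE tmapE !qextE coker_mapE !coker_liftE.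
- move=> q; apply: qtens_ext => k; have [y ->] := coker_surj k.
  by rewrite [LHS]comp_linE tmapE coker_mapE qextE coker_liftE.
- move=> Y; apply: quad_hom_ext => [x|y]; first by rewrite [LHS]zero_modP [RHS]zero_modP.
  by rewrite [LHS]qextE coker_liftE.
Defined.

Lemma ZP_ker0 (Y : lmodType Q) (y : restr pi Y) : tilde (qg (Z_B_ob Y)) y = 0.
Proof. exact/(@ker_tildeP (Z_B_ob Y)). Qed.

Lemma ZP_unit_linear (Y : lmodType Q) :
  linear (fun y : Y => qb1 phi *t (ker_sub (ZP_ker0 y)) : P_B_ob (Z_B_ob Y)).
Proof.
move=> q y z; have [b ->] := qpi_surj q; rewrite -/(pi b) pi_pure -tpureDr.
by congr tpure; apply: ker_val_inj; rewrite [RHS]linearP !ker_subE.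
Qed.

Definition ZP_unit (Y : lmodType Q) : {linear Y -> P_B_ob (Z_B_ob Y)} :=
  mk_lin (@ZP_unit_linear Y).

Lemma ZP_ann (q : quad C) u (k : kermod (tilde (qg q))) : (phi u : B) *: k = 0.
Proof.
apply: ker_val_inj; rewrite linearZ linear0 /=.
have /ker_tildeP hk := ker_valP k.
elim/tens_ind: u => [|m n|t u IHt IHu].
- by rewrite linear0 scale0r.
- by rewrite -qfg hk tpure0r linear0.
- by rewrite linearD scalerDl IHt IHu addr0.
Qed.

Definition ZP_counitY (q : quad C) : {linear restr pi (P_B_ob q) -> qY q} :=
  comp_lin (@ker_val _ _ _ (tilde (qg q))) (ann_eval (@ZP_ann q)).

Lemma ZP_counitE (q : quad C) k : ZP_counitY q (qb1 phi *t k) = ker_val k.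
Proof. by rewrite comp_linE ann_evalE. Qed.

Lemma ZP_counit1 (q : quad C) t :
  ZP_counitY q (qf (Z_B_ob (P_B_ob q)) t)
  = qf q (tmap M (zero_lin (zero_mod A) (qX q)) t).
Proof.
rewrite linear0; elim/tens_ind: t => [|m x|t u IHt IHu].
- by rewrite !linear0.
- by rewrite tmapE tpure0r linear0.
- by rewrite !linearD -IHt -IHu addr0.
Qed.

Lemma qpure_surj (K : lmodType B) (t : tens (qbimod phi) K) :
  exists k, t = qb1 phi *t k.
Proof.
elim/tens_ind: t => [|p k|t u [k ->] [l ->]].
- by exists 0; rewrite tpure0r.
- have [b hb] := qpi_surj (p : Q); exists (b *: k).
  by rewrite qb_pure hb -/(pi b) pi_pure.
- by exists (k + l); rewrite tpureDr.
Qed.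

Lemma ZP_counit2 (q : quad C) t :
  zero_lin (zero_mod A) (qX q) (qg (Z_B_ob (P_B_ob q)) t)
  = qg q (tmap N (ZP_counitY q) t).
Proof.
rewrite linear0; elim/tens_ind: t => [|n t|t u IHt IHu].
- by rewrite !linear0.
- have [k hk] := @qpure_surj (kermod (tilde (qg q))) t.
  rewrite tmapE hk ZP_counitE.
  by have /ker_tildeP -> := ker_valP k.
- by rewrite !linearD -IHt -IHu addr0.
Qed.

Definition ZP_counit (q : quad C) : quad_hom (Z_B_ob (P_B_ob q)) q :=
  @QuadHom A B C (Z_B_ob (P_B_ob q)) q (zero_lin (zero_mod A) (qX q)) (ZP_counitY q)
    (@ZP_counit1 q) (@ZP_counit2 q).

Lemma ZP_unit_nat (Y Y' : lmodType Q) (f : {linear Y -> Y'}) y :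
  P_B_hom (Z_B_hom f) (ZP_unit Y y) = ZP_unit Y' (f y).
Proof. by rewrite [LHS]tmapE; congr tpure; apply: ker_val_inj. Qed.

Lemma ZP_counit_nat (p q : quad C) (h : quad_hom p q) (t : restr pi (P_B_ob p)) :
  qb h (ZP_counitY p t) = ZP_counitY q (restr_lin (P_B_hom h) t).
Proof.
have [k ->] := @qpure_surj (kermod (tilde (qg p))) t.
have -> : restr_lin (P_B_hom h) (qb1 phi *t k)
    = qb1 phi *t ker_map (@P_B_hom_subproof p q h) k :> restr pi (P_B_ob q).
  exact: (tmapE (ker_map (@P_B_hom_subproof p q h)) (qb1 phi) k).
by rewrite !ZP_counitE ker_mapE.
Qed.

Lemma ZP_triangleL (Y : lmodType Q) y : ZP_counitY (Z_B_ob Y) (ZP_unit Y y) = y.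
Proof. by rewrite [LHS]ZP_counitE ker_subE. Qed.

Lemma ZP_triangleR (q : quad C) :
  comp_lin (P_B_hom (ZP_counit q)) (ZP_unit (P_B_ob q)) = id_lin (P_B_ob q).
Proof.
apply: qtens_ext => k; rewrite comp_linE id_linE.
rewrite [LHS](tmapE (ker_map (@P_B_hom_subproof _ _ (ZP_counit q)))).
congr tpure; apply: ker_val_inj; rewrite ker_mapE ker_subE.
exact: ZP_counitE.
Qed.

Definition adj_Z_P : adjunction Z_B P_B.
Proof.
refine (@Adjunction (ModCat Q) (QuadCat C) Z_B P_B ZP_unit ZP_counit _ _ _ _).
- by move=> Y Y' f; apply: lin_ext => y; apply: ZP_unit_nat.
- move=> p q h; apply: quad_hom_ext => [x|t]; last exact: ZP_counit_nat.
  exact: (linear0 (qa h)).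
- move=> Y; apply: quad_hom_ext => [x|y]; last exact: ZP_triangleL.
  by rewrite [LHS]zero_modP [RHS]zero_modP.
- exact: ZP_triangleR.
Defined.

Lemma Z_B_ff : fully_faithful Z_B.
Proof.
move=> Y Y'; exists (fun h : quad_hom (Z_B_ob Y) (Z_B_ob Y') => unrestr (qb h)).
  by move=> f; apply: lin_ext.
by move=> h; apply: quad_hom_ext => // x; rewrite [LHS]zero_modP [RHS]zero_modP.
Qed.

Lemma T_A_ff : fully_faithful T_A.
Proof.
move=> X X'; exists (fun h : quad_hom (T_A_ob X) (T_A_ob X') => qa h) => // h.
by apply: quad_hom_ext => // t; rewrite [RHS](qaf h).
Qed.

Lemma H_A_ff : fully_faithful H_A.
Proof.
move=> X X'; exists (fun h : quad_hom (H_A_ob X) (H_A_ob X') => qa h) => // h.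
apply: quad_hom_ext => // k; apply: hom_ext => n; rewrite hmapE.
have := qbg h (n *t (k : qY (H_A_ob X))); rewrite tmapE [RHS]tliftE => <-.
by congr (qa h _); rewrite [RHS]tliftE.
Qed.

Lemma ker_U_A (q : quad C) :
  is_zero (U_A q) <-> exists Y : lmodType Q, isomorphic (Z_B Y) (q : QuadCat C).
Proof.
rewrite is_zero_mod; split=> [X0|[Y [f [g [gf fg]]]] x]; last first.
  have /(congr1 (fun h : quad_hom q q => qa h x)) := fg; rewrite [RHS]/= => <-.
  by rewrite [LHS](congr1 (qa f) (zero_modP _)) linear0.
have hV u (y : qY q) : (phi u : B) *: y = 0.
  elim/tens_ind: u => [|m n|t u IHt IHu].
  - by rewrite linear0 scale0r.
  - by rewrite -qfg [qg q _]X0 tpure0r linear0.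
  - by rewrite linearD scalerDl IHt IHu addr0.
have f0 t : qf q t = 0.
  elim/tens_ind: t => [|m x|t u IHt IHu].
  - by rewrite linear0.
  - by rewrite [x]X0 tpure0r linear0.
  - by rewrite linearD IHt IHu addr0.
pose Y := ann_mod hV; exists Y.
have h1 t : ann_out hV (qf (Z_B_ob Y) t) = qf q (tmap M (zero_lin (zero_mod A) (qX q)) t).
  by rewrite f0 linear0.
have h2 t : zero_lin (zero_mod A) (qX q) (qg (Z_B_ob Y) t) = qg q (tmap N (ann_out hV) t).
  by rewrite [LHS]X0 [RHS]X0.
have k1 t : ann_in hV (qf q t) = qf (Z_B_ob Y) (tmap M (zero_lin (qX q) (zero_mod A)) t).
  by rewrite f0 linear0.
have k2 t : zero_lin (qX q) (zero_mod A) (qg q t) = qg (Z_B_ob Y) (tmap N (ann_in hV) t).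
  by [].
exists (@QuadHom A B C (Z_B_ob Y) q _ _ h1 h2), (@QuadHom A B C q (Z_B_ob Y) _ _ k1 k2).
split; apply: quad_hom_ext => // x.
by rewrite [LHS]zero_modP [RHS]zero_modP.
Qed.

Definition recollement_A : recollement Q_B Z_B P_B T_A U_A H_A :=
  @Recollement (ModCat Q) (QuadCat C) (ModCat A) Q_B Z_B P_B T_A U_A H_A
    adj_Q_Z adj_Z_P adj_T_U adj_U_H Z_B_ff T_A_ff H_A_ff ker_U_A.

End First.

(* The recollement at the idempotent [0 0; 0 1] is the one at [1 0; 0 0] with *)
(* the roles of (A, N, psi) and (B, M, phi) exchanged; the section Explicit *)
(* below spells out the resulting functors. *)
Definition morita_swap (A B : pzRingType) (C : morita A B) : morita B A :=
  @Morita B A (bimM C) (bimN C) (psi C) (phi C)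
    (fun m m' n => @psi_phi A B C n m m') (fun m n n' => @phi_psi A B C n n' m).

Section Swap.
Variables (A B : pzRingType) (C : morita A B).

Definition quad_swap (q : quad C) : quad (morita_swap C) :=
  @Quad B A (morita_swap C) (qY q) (qX q) (qg q) (qf q) (@qfg A B C q) (@qgf A B C q).

Definition quad_hom_swap (p q : quad C) (h : quad_hom p q) :
    quad_hom (quad_swap p) (quad_swap q) :=
  @QuadHom B A (morita_swap C) (quad_swap p) (quad_swap q) (qb h) (qa h)
    (@qbg _ _ _ _ _ h) (@qaf _ _ _ _ _ h).

Definition Swap : functor (QuadCat C) (QuadCat (morita_swap C)).
Proof.
refine (@Functor (QuadCat C) (QuadCat (morita_swap C)) quad_swap quad_hom_swap _ _).
- by move=> q; apply: quad_hom_ext.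
- by move=> p q r g f; apply: quad_hom_ext.
Defined.

End Swap.

Section Unswap.
Variables (A B : pzRingType) (C : morita A B).

Definition Unswap : functor (QuadCat (morita_swap C)) (QuadCat C) :=
  Swap (morita_swap C).

Variable D : category.

Lemma Unswap_eq (p q r : quad (morita_swap C)) (g : quad_hom q r) (f : quad_hom p q)
    (h : quad_hom p r) :
  quad_comp g f = h -> quad_comp (fmap Unswap g) (fmap Unswap f) = fmap Unswap h.
Proof. by move=> <-; apply: quad_hom_ext. Qed.

Lemma Unswap_eq4 (p q r s : quad (morita_swap C)) (g : quad_hom q r) (f : quad_hom p q)
    (g' : quad_hom s r) (f' : quad_hom p s) :
  quad_comp g f = quad_comp g' f' ->
  quad_comp (fmap Unswap g) (fmap Unswap f) = quad_comp (fmap Unswap g') (fmap Unswap f').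
Proof. by move=> /Unswap_eq ->; apply: quad_hom_ext. Qed.

Lemma Unswap_eq1 (p q : quad (morita_swap C)) (g : quad_hom q p) (f : quad_hom p q) :
  quad_comp g f = quad_id p ->
  quad_comp (fmap Unswap g) (fmap Unswap f) = quad_id (Unswap p).
Proof. by move=> /Unswap_eq ->; apply: quad_hom_ext. Qed.

Lemma Swap_eq1 (p q : quad C) (g : quad_hom q p) (f : quad_hom p q) :
  quad_comp g f = quad_id p ->
  quad_comp (fmap (Swap C) g) (fmap (Swap C) f) = quad_id (Swap C p).
Proof.
move=> gf; apply: quad_hom_ext => x.
  exact: (congr1 (fun h : quad_hom p p => qb h x) gf).
exact: (congr1 (fun h : quad_hom p p => qa h x) gf).
Qed.

Definition adj_swapl (L : functor (QuadCat (morita_swap C)) D)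
    (R : functor D (QuadCat (morita_swap C))) (adj : adjunction L R) :
  adjunction (functor_comp L (Swap C)) (functor_comp Unswap R).
Proof.
refine (@Adjunction (QuadCat C) D (functor_comp L (Swap C)) (functor_comp Unswap R)
  (fun q => fmap Unswap (adj_unit adj (Swap C q))) (fun Y => adj_counit adj Y) _ _ _ _).
- move=> p q h; exact: (Unswap_eq4 (unit_nat adj (fmap (Swap C) h))).
- move=> Y Y' f; exact: (counit_nat adj f).
- move=> q; exact: (triangleL adj (Swap C q)).
- move=> Y; exact: (Unswap_eq1 (triangleR adj Y)).
Defined.

Definition adj_swapr (L : functor D (QuadCat (morita_swap C)))
    (R : functor (QuadCat (morita_swap C)) D) (adj : adjunction L R) :
  adjunction (functor_comp Unswap L) (functor_comp R (Swap C)).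
Proof.
refine (@Adjunction D (QuadCat C) (functor_comp Unswap L) (functor_comp R (Swap C))
  (fun X => adj_unit adj X) (fun q => fmap Unswap (adj_counit adj (Swap C q))) _ _ _ _).
- move=> X X' f; exact: (unit_nat adj f).
- move=> p q h; exact: (Unswap_eq4 (counit_nat adj (fmap (Swap C) h))).
- move=> X; exact: (Unswap_eq1 (triangleL adj X)).
- move=> q; exact: (triangleR adj (Swap C q)).
Defined.

Lemma ff_swap (F : functor D (QuadCat (morita_swap C))) :
  fully_faithful F -> fully_faithful (functor_comp Unswap F).
Proof.
move=> Fff X X'; have [k fk kf] := Fff X X'.
exists (fun h : quad_hom (Unswap (F X)) (Unswap (F X')) => k (quad_hom_swap h)).
  by move=> h; apply: fk.
by move=> h; apply: (congr1 (fmap Unswap) (kf (quad_hom_swap h))).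
Qed.

Lemma isomorphic_swap (p : quad (morita_swap C)) (q : quad C) :
  isomorphic (Unswap p) (q : QuadCat C) <->
  isomorphic (p : QuadCat (morita_swap C)) (Swap C q).
Proof.
split=> -[f [g [gf fg]]].
  exists (fmap (Swap C) f), (fmap (Swap C) g).
  split; [exact: (Swap_eq1 gf) | exact: (Swap_eq1 fg)].
exists (fmap Unswap f), (fmap Unswap g).
split; [exact: (Unswap_eq1 gf) | exact: (Unswap_eq1 fg)].
Qed.

End Unswap.

Section Second.
Variables (A B : pzRingType) (C : morita A B).
Local Notation C' := (morita_swap C).
Local Notation M := (bimM C).
Local Notation N := (bimN C).
Local Notation Q' := (qring (psi C)).

Definition Phi (Y : lmodType B) : {linear tens M (tens N Y) -> Y} := Psi C' Y.

Lemma PhiE (Y : lmodType B) m n (y : Y) :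
  Phi Y (m *t (n *t y)) = (phi C (m *t n) : B) *: y.
Proof. exact: (@PsiE _ _ C'). Qed.

Definition Q_A : functor (QuadCat C) (ModCat Q') := functor_comp (Q_B C') (Swap C).
Definition Z_A : functor (ModCat Q') (QuadCat C) := functor_comp (Unswap C) (Z_B C').
Definition P_A : functor (QuadCat C) (ModCat Q') := functor_comp (P_B C') (Swap C).
Definition T_B : functor (ModCat B) (QuadCat C) := functor_comp (Unswap C) (T_A C').
Definition U_B : functor (QuadCat C) (ModCat B) := functor_comp (U_A C') (Swap C).
Definition H_B : functor (ModCat B) (QuadCat C) := functor_comp (Unswap C) (H_A C').

Lemma ker_U_B (q : quad C) :
  is_zero (U_B q) <-> exists Y : lmodType Q', isomorphic (Z_A Y) (q : QuadCat C).
Proof.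
rewrite (ker_U_A (quad_swap q)).
by split=> -[Y hY]; exists Y; apply/isomorphic_swap.
Qed.

Definition recollement_B : recollement Q_A Z_A P_A T_B U_B H_B :=
  @Recollement (ModCat Q') (QuadCat C) (ModCat B) Q_A Z_A P_A T_B U_B H_B
    (adj_swapl (adj_Q_Z C')) (adj_swapr (adj_Z_P C'))
    (adj_swapr (adj_T_U C')) (adj_swapl (adj_U_H C'))
    (ff_swap (@Z_B_ff _ _ C')) (ff_swap (@T_A_ff _ _ C')) (ff_swap (@H_A_ff _ _ C')) ker_U_B.

End Second.

Section Explicit.
Variables (A B : pzRingType) (C : morita A B).
Local Notation M := (bimM C).
Local Notation N := (bimN C).

Fact Q_B_E (q : quad C) : Q_B C q = tens (qbimod (phi C)) (coker (qf q)).
Proof. by []. Qed.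
Fact Z_B_E Y : Z_B C Y = @Quad A B C (zero_mod A) (restr (qring_pi (phi C)) Y)
  \0 \0 (@Z_B_qgf A B C Y) (@Z_B_qfg A B C Y).
Proof. by []. Qed.
Fact P_B_E (q : quad C) : P_B C q = tens (qbimod (phi C)) (kermod (tilde (qg q))).
Proof. by []. Qed.
Fact T_A_E X : T_A C X = @Quad A B C X (tens M X) (id_lin _) (Psi C X)
  (@T_A_qgf A B C X) (@T_A_qfg A B C X).
Proof. by []. Qed.
Fact U_A_E (q : quad C) : U_A C q = qX q.
Proof. by []. Qed.
Fact H_A_E X : H_A C X = @Quad A B C X (hommod N X) (tilde (Psi C X)) (evalmod N X)
  (@H_A_qgf A B C X) (@H_A_qfg A B C X).
Proof. by []. Qed.

Fact Q_A_E (q : quad C) : Q_A C q = tens (qbimod (psi C)) (coker (qg q)).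
Proof. by []. Qed.
Fact Z_A_E X : Z_A C X = @Quad A B C (restr (qring_pi (psi C)) X) (zero_mod B) \0 \0
  (@Z_B_qfg B A (morita_swap C) X) (@Z_B_qgf B A (morita_swap C) X).
Proof. by []. Qed.
Fact P_A_E (q : quad C) : P_A C q = tens (qbimod (psi C)) (kermod (tilde (qf q))).
Proof. by []. Qed.
Fact T_B_E Y : T_B C Y = @Quad A B C (tens N Y) Y (Phi C Y) (id_lin _)
  (@T_A_qfg B A (morita_swap C) Y) (@T_A_qgf B A (morita_swap C) Y).
Proof. by []. Qed.
Fact U_B_E (q : quad C) : U_B C q = qY q.
Proof. by []. Qed.
Fact H_B_E Y : H_B C Y = @Quad A B C (hommod M Y) Y (evalmod M Y) (tilde (Phi C Y))
  (@H_A_qfg B A (morita_swap C) Y) (@H_A_qgf B A (morita_swap C) Y).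
Proof. by []. Qed.

Fact counit_A_E (q : quad C) :
  qa (adj_counit (rec_jl_j (recollement_A C)) q) = id_lin (qX q) /\
  qb (adj_counit (rec_jl_j (recollement_A C)) q) = qf q.
Proof. by []. Qed.
Fact counit_B_E (q : quad C) :
  qa (adj_counit (rec_jl_j (recollement_B C)) q) = qg q /\
  qb (adj_counit (rec_jl_j (recollement_B C)) q) = id_lin (qY q).
Proof. by []. Qed.

End Explicit.

Section QuadModule.
Variables (A B : pzRingType) (C : morita A B).
Local Notation M := (bimM C).
Local Notation N := (bimN C).
Local Notation L := (morita_ring C).

Section Carrier.
Variable q : quad C.

Definition quadT : Type := (qX q * qY q)%type.
HB.instance Definition _ := GRing.Zmodule.on quadT.

Definition quad_scale (u : L) (v : quadT) : quadT :=
  (mat11 u *: v.1 + qg q (mat12 u *t v.2), qf q (mat21 u *t v.1) + mat22 u *: v.2).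

Lemma quad_scaleA u v w : quad_scale u (quad_scale v w) = quad_scale (u * v) w.
Proof.
case: u v w => a n m b [a' n' m' b'] [x y]; rewrite /quad_scale /=; congr pair.
- rewrite scalerDr scalerDl scalerA !tpureDr tpureDl !linearD qgf /=.
  rewrite tpureZl linearZ tpure_bal -!addrA; congr (_ + _).
  by rewrite addrCA.
- rewrite scalerDr scalerDl scalerA !tpureDr tpureDl !linearD qfg /=.
  rewrite tpureZl linearZ tpure_bal -!addrA; congr (_ + _).
  by rewrite addrCA.
Qed.
Lemma quad_scale1 : left_id 1 quad_scale.
Proof.
case=> x y; rewrite /quad_scale /= !scale1r !tpure0l.
by congr pair; rewrite linear0 ?addr0 ?add0r.
Qed.
Lemma quad_scaleDr : right_distributive quad_scale +%R.
Proof.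
move=> u [x y] [x' y']; congr pair => /=.
  by rewrite scalerDr tpureDr linearD addrACA.
by rewrite scalerDr tpureDr linearD addrACA.
Qed.
Lemma quad_scaleDl v : {morph quad_scale^~ v : u w / u + w}.
Proof.
move=> u w; congr pair => /=.
  by rewrite scalerDl tpureDl linearD addrACA.
by rewrite scalerDl tpureDl linearD addrACA.
Qed.

HB.instance Definition _ := GRing.Zmodule_isLmodule.Build L quadT
  quad_scaleA quad_scale1 quad_scaleDr quad_scaleDl.

Definition quad_mod : lmodType L := quadT.

End Carrier.

Lemma quad_mod_hom_linear (p q : quad C) (h : quad_hom p q) :
  linear (fun v : quad_mod p => (qa h v.1, qb h v.2) : quad_mod q).
Proof.
move=> u [x y] [x' y']; congr pair => /=.
  by rewrite !linearD linearZ qbg tmapE.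
by rewrite !linearD linearZ qaf tmapE.
Qed.

Definition quad_mod_hom (p q : quad C) (h : quad_hom p q) :
  {linear quad_mod p -> quad_mod q} := mk_lin (quad_mod_hom_linear h).

Definition QuadMod : functor (QuadCat C) (ModCat L).
Proof.
refine (@Functor (QuadCat C) (ModCat L) quad_mod quad_mod_hom _ _).
- by move=> q; apply: lin_ext => -[x y].
- by move=> p q r g f; apply: lin_ext => -[x y].
Defined.

Section Faithful.
Variables (p q : quad C) (k : {linear quad_mod p -> quad_mod q}).

Definition pX (x : qX p) : quad_mod p := (x, 0).
Definition pY (y : qY p) : quad_mod p := (0, y).

Lemma pX_scale (u : L) x : u *: pX x = pX (mat11 u *: x) + pY (qf p (mat21 u *t x)).
Proof.
congr pair => /=; last by rewrite scaler0 addr0 add0r.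
by rewrite tpure0r linear0 !addr0.
Qed.
Lemma pY_scale (u : L) y : u *: pY y = pX (qg p (mat12 u *t y)) + pY (mat22 u *: y).
Proof.
congr pair => /=; first by rewrite scaler0 addr0 add0r.
by rewrite tpure0r linear0 !add0r.
Qed.
Lemma pXD x x' : pX (x + x') = pX x + pX x'.
Proof. by congr pair; rewrite addr0. Qed.
Lemma pYD y y' : pY (y + y') = pY y + pY y'.
Proof. by congr pair; rewrite addr0. Qed.
Lemma pX0 : pX 0 = 0. Proof. by []. Qed.
Lemma pY0 : pY 0 = 0. Proof. by []. Qed.

Lemma kX x : k (pX x) = ((k (pX x)).1, 0).
Proof.
have e : (Mat (C := C) 1 0 0 0 : L) *: pX x = pX x.
  by rewrite pX_scale /= scale1r tpure0l linear0 pY0 addr0.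
rewrite -{1}e linearZ; congr pair => /=.
  by rewrite scale1r tpure0l linear0 addr0.
by rewrite tpure0l linear0 scale0r addr0.
Qed.
Lemma kY y : k (pY y) = (0, (k (pY y)).2).
Proof.
have e : (Mat (C := C) 0 0 0 1 : L) *: pY y = pY y.
  by rewrite pY_scale /= scale1r tpure0l linear0 pX0 add0r.
rewrite -{1}e linearZ; congr pair => /=.
  by rewrite tpure0l linear0 scale0r addr0.
by rewrite scale1r tpure0l linear0 add0r.
Qed.

Lemma ka_linear : linear (fun x => (k (pX x)).1).
Proof.
move=> a x x'; rewrite pXD linearD /=; congr (_ + _).
have -> : pX (a *: x) = (Mat (C := C) a 0 0 0 : L) *: pX x.
  by rewrite pX_scale /= tpure0l linear0 pY0 addr0.
by rewrite linearZ /= tpure0l linear0 addr0.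
Qed.
Lemma kb_linear : linear (fun y => (k (pY y)).2).
Proof.
move=> b y y'; rewrite pYD linearD /=; congr (_ + _).
have -> : pY (b *: y) = (Mat (C := C) 0 0 0 b : L) *: pY y.
  by rewrite pY_scale /= tpure0l linear0 pX0 add0r.
by rewrite linearZ /= tpure0l linear0 add0r.
Qed.
Definition ka := mk_lin ka_linear.
Definition kb := mk_lin kb_linear.

Lemma kaf t : kb (qf p t) = qf q (tmap M ka t).
Proof.
elim/tens_ind: t => [|m x|t u IHt IHu]; last by rewrite !linearD IHt IHu.
  by rewrite !linear0.
have e : (Mat (C := C) 0 0 m 0 : L) *: pX x = pY (qf p (m *t x)).
  by rewrite pX_scale /= scale0r pX0 add0r.
by rewrite tmapE [LHS]/= -e linearZ /= scale0r addr0.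
Qed.
Lemma kbg t : ka (qg p t) = qg q (tmap N kb t).
Proof.
elim/tens_ind: t => [|n y|t u IHt IHu]; last by rewrite !linearD IHt IHu.
  by rewrite !linear0.
have e : (Mat (C := C) 0 n 0 0 : L) *: pY y = pX (qg p (n *t y)).
  by rewrite pY_scale /= scale0r pY0 addr0.
by rewrite tmapE [LHS]/= -e linearZ /= scale0r add0r.
Qed.

End Faithful.

Lemma QuadMod_ff : fully_faithful QuadMod.
Proof.
move=> p q; exists (fun k => QuadHom (kaf k) (kbg k)) => [h|k].
  by apply: quad_hom_ext.
apply: lin_ext => -[x y]; have -> : (x, y) = pX x + pY y :> quad_mod p.
  by congr pair; rewrite ?addr0 ?add0r.
by rewrite !linearD [in RHS]kX [in RHS]kY; congr (_ + _); congr pair; rewrite linear0.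
Qed.

Section Peirce.
Variable V : lmodType L.

Definition eA : L := Mat (C := C) 1 0 0 0.
Definition eB : L := Mat (C := C) 0 0 0 1.
Definition inA (a : A) : L := Mat (C := C) a 0 0 0.
Definition inB (b : B) : L := Mat (C := C) 0 0 0 b.
Definition inM (m : M) : L := Mat (C := C) 0 0 m 0.
Definition inN (n : N) : L := Mat (C := C) 0 n 0 0.

Ltac mat_tac := rewrite [LHS]/GRing.mul /= /mat_mul /= ?tpure0l ?tpure0r
  ?linear0 ?ract0l ?ract0r ?scaler0 ?scale0r ?mulr0 ?mul0r ?mulr1 ?mul1r
  ?addr0 ?add0r ?scale1r ?ract1 //.

Lemma inA_M a a' : inA a * inA a' = inA (a * a'). Proof. by mat_tac. Qed.
Lemma inB_M b b' : inB b * inB b' = inB (b * b'). Proof. by mat_tac. Qed.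
Lemma inNM n m : inN n * inM m = inA (psi C (n *t m)). Proof. by mat_tac. Qed.
Lemma inMN m n : inM m * inN n = inB (phi C (m *t n)). Proof. by mat_tac. Qed.
Lemma inBM b m : inB b * inM m = inM (b *: m). Proof. by mat_tac. Qed.
Lemma inMA m a : inM m * inA a = inM (ract m a). Proof. by mat_tac. Qed.
Lemma inAN a n : inA a * inN n = inN (a *: n). Proof. by mat_tac. Qed.
Lemma inNB n b : inN n * inB b = inN (ract n b). Proof. by mat_tac. Qed.
Lemma inAB a b : inA a * inB b = 0. Proof. by mat_tac. Qed.
Lemma inBA a b : inB b * inA a = 0. Proof. by mat_tac. Qed.
Lemma inAM a m : inA a * inM m = 0. Proof. by mat_tac. Qed.
Lemma inBN b n : inB b * inN n = 0. Proof. by mat_tac. Qed.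
Lemma inMB m b : inM m * inB b = 0. Proof. by mat_tac. Qed.
Lemma inNA n a : inN n * inA a = 0. Proof. by mat_tac. Qed.

Ltac add_tac := congr Mat => /=; rewrite ?addr0 //.
Lemma inAD a a' : inA (a + a') = inA a + inA a'. Proof. by add_tac. Qed.
Lemma inBD b b' : inB (b + b') = inB b + inB b'. Proof. by add_tac. Qed.
Lemma inMD m m' : inM (m + m') = inM m + inM m'. Proof. by add_tac. Qed.
Lemma inND n n' : inN (n + n') = inN n + inN n'. Proof. by add_tac. Qed.
Lemma mat_dec (u : L) :
  u = (inA (mat11 u) + inN (mat12 u)) + (inM (mat21 u) + inB (mat22 u)).
Proof. by case: u => a n m b; congr Mat => /=; rewrite ?addr0 ?add0r. Qed.
Lemma eAB : eA + eB = 1.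
Proof. by congr Mat => /=; rewrite ?addr0 ?add0r. Qed.

Definition in_eA : {pred V} := fun v => eA *: v == v.
Definition in_eB : {pred V} := fun v => eB *: v == v.

Lemma in_eA_zmod : zmod_closed in_eA.
Proof.
split=> [|v w]; rewrite !unfold_in /in_eA; first by rewrite scaler0.
by move=> /eqP hv /eqP hw; rewrite scalerBr hv hw.
Qed.
Lemma in_eB_zmod : zmod_closed in_eB.
Proof.
split=> [|v w]; rewrite !unfold_in /in_eB; first by rewrite scaler0.
by move=> /eqP hv /eqP hw; rewrite scalerBr hv hw.
Qed.
HB.instance Definition _ := GRing.isZmodClosed.Build V in_eA in_eA_zmod.
HB.instance Definition _ := GRing.isZmodClosed.Build V in_eB in_eB_zmod.

Definition eAT := {v : V | v \in in_eA}.
HB.instance Definition _ := SubChoice.on eAT.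
HB.instance Definition _ := [SubChoice_isSubZmodule of eAT by <:].
Definition eBT := {v : V | v \in in_eB}.
HB.instance Definition _ := SubChoice.on eBT.
HB.instance Definition _ := [SubChoice_isSubZmodule of eBT by <:].

Definition vA (x : eAT) : V := val x.
Definition vB (y : eBT) : V := val y.
Lemma vA_inj : injective vA. Proof. exact: val_inj. Qed.
Lemma vB_inj : injective vB. Proof. exact: val_inj. Qed.
Lemma vAD x x' : vA (x + x') = vA x + vA x'. Proof. by []. Qed.
Lemma vBD y y' : vB (y + y') = vB y + vB y'. Proof. by []. Qed.
Lemma vA_e x : eA *: vA x = vA x. Proof. exact/eqP/(valP x). Qed.
Lemma vB_e y : eB *: vB y = vB y. Proof. exact/eqP/(valP y). Qed.

Definition mkA (v : V) (h : eA *: v = v) : eAT := Sub v (introT eqP h : v \in in_eA).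
Definition mkB (v : V) (h : eB *: v = v) : eBT := Sub v (introT eqP h : v \in in_eB).
Lemma mkAE v h : vA (@mkA v h) = v. Proof. exact: SubK. Qed.
Lemma mkBE v h : vB (@mkB v h) = v. Proof. exact: SubK. Qed.

Lemma actA_e a x : eA *: (inA a *: vA x) = inA a *: vA x.
Proof. by rewrite scalerA inA_M mul1r. Qed.
Lemma actB_e b y : eB *: (inB b *: vB y) = inB b *: vB y.
Proof. by rewrite scalerA inB_M mul1r. Qed.
Lemma actM_e m x : eB *: (inM m *: vA x) = inM m *: vA x.
Proof. by rewrite scalerA inBM scale1r. Qed.
Lemma actN_e n y : eA *: (inN n *: vB y) = inN n *: vB y.
Proof. by rewrite scalerA inAN scale1r. Qed.

Definition actA a x : eAT := mkA (actA_e a x).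
Definition actB b y : eBT := mkB (actB_e b y).

Lemma actAA a b x : actA a (actA b x) = actA (a * b) x.
Proof. by apply: vA_inj; rewrite !mkAE scalerA inA_M. Qed.
Lemma actA1 : left_id 1 actA.
Proof. by move=> x; apply: vA_inj; rewrite mkAE vA_e. Qed.
Lemma actADr : right_distributive actA +%R.
Proof. by move=> a x y; apply: vA_inj; rewrite vAD !mkAE vAD scalerDr. Qed.
Lemma actADl x : {morph actA^~ x : a b / a + b}.
Proof. by move=> a b; apply: vA_inj; rewrite vAD !mkAE inAD scalerDl. Qed.
HB.instance Definition _ :=
  GRing.Zmodule_isLmodule.Build A eAT actAA actA1 actADr actADl.

Lemma actBA a b x : actB a (actB b x) = actB (a * b) x.
Proof. by apply: vB_inj; rewrite !mkBE scalerA inB_M. Qed.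
Lemma actB1 : left_id 1 actB.
Proof. by move=> x; apply: vB_inj; rewrite mkBE vB_e. Qed.
Lemma actBDr : right_distributive actB +%R.
Proof. by move=> a x y; apply: vB_inj; rewrite vBD !mkBE vBD scalerDr. Qed.
Lemma actBDl x : {morph actB^~ x : a b / a + b}.
Proof. by move=> a b; apply: vB_inj; rewrite vBD !mkBE inBD scalerDl. Qed.
HB.instance Definition _ :=
  GRing.Zmodule_isLmodule.Build B eBT actBA actB1 actBDr actBDl.

Definition XV : lmodType A := eAT.
Definition YV : lmodType B := eBT.

Lemma vAZ a (x : XV) : vA (a *: x) = inA a *: vA x. Proof. exact: mkAE. Qed.
Lemma vBZ b (y : YV) : vB (b *: y) = inB b *: vB y. Proof. exact: mkBE. Qed.

Lemma fV_bal : balanced (fun (m : M) (x : XV) => mkB (actM_e m x) : YV).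
Proof.
split=> [m m' x|m x x'|m a x|b m x]; apply: vB_inj.
- by rewrite vBD !mkBE inMD scalerDl.
- by rewrite vBD !mkBE vAD scalerDr.
- by rewrite !mkBE vAZ scalerA inMA.
- by rewrite vBZ !mkBE scalerA inBM.
Qed.
Lemma gV_bal : balanced (fun (n : N) (y : YV) => mkA (actN_e n y) : XV).
Proof.
split=> [m m' x|m x x'|m a x|b m x]; apply: vA_inj.
- by rewrite vAD !mkAE inND scalerDl.
- by rewrite vAD !mkAE vBD scalerDr.
- by rewrite !mkAE vBZ scalerA inNB.
- by rewrite vAZ !mkAE scalerA inAN.
Qed.
Definition fV : {linear tens M XV -> YV} := tlift fV_bal.
Definition gV : {linear tens N YV -> XV} := tlift gV_bal.

Lemma fVE m x : vB (fV (m *t x)) = inM m *: vA x.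
Proof. by rewrite tliftE mkBE. Qed.
Lemma gVE n y : vA (gV (n *t y)) = inN n *: vB y.
Proof. by rewrite tliftE mkAE. Qed.

Lemma qgfV (n : N) (m : M) (x : XV) :
  gV (n *t fV (m *t x)) = (psi C (n *t m) : A) *: x.
Proof. by apply: vA_inj; rewrite gVE fVE scalerA inNM vAZ. Qed.
Lemma qfgV (m : M) (n : N) (y : YV) :
  fV (m *t gV (n *t y)) = (phi C (m *t n) : B) *: y.
Proof. by apply: vB_inj; rewrite fVE gVE scalerA inMN vBZ. Qed.

Definition quadV : quad C := @Quad A B C XV YV fV gV qgfV qfgV.

Lemma toV_linear : linear (fun v : quad_mod quadV => vA v.1 + vB v.2).
Proof.
move=> u [x y] [x' y'] /=.
rewrite ![vA (_ + _)]vAD ![vB (_ + _)]vBD vAZ vBZ gVE fVE addrACA; congr (_ + _).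
rewrite [u in RHS]mat_dec !scalerDl !scalerDr.
rewrite -(vA_e x) -(vB_e y) !scalerA !inA_M !inB_M !inMA !inNB !inAB !inBA !inMB !inNA.
rewrite !mulr1 !ract1 !scale0r !addr0 !add0r.
by rewrite -!addrA; congr (_ + _); rewrite addrCA addrA.
Qed.

Lemma eA_idem (v : V) : eA *: (eA *: v) = eA *: v.
Proof. by rewrite scalerA inA_M mulr1. Qed.
Lemma eB_idem (v : V) : eB *: (eB *: v) = eB *: v.
Proof. by rewrite scalerA inB_M mulr1. Qed.

Definition fromV_fun (v : V) : quad_mod quadV :=
  ((mkA (eA_idem v) : XV), (mkB (eB_idem v) : YV)).

Definition toV : {linear quad_mod quadV -> V} := mk_lin toV_linear.

Lemma toVK : cancel toV fromV_fun.
Proof.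
case=> x y; congr pair; [apply: vA_inj | apply: vB_inj]; rewrite ?mkAE ?mkBE /=.
  by rewrite scalerDr vA_e -(vB_e y) scalerA inAB scale0r addr0.
by rewrite scalerDr vB_e -(vA_e x) scalerA inBA scale0r add0r.
Qed.
Lemma fromVK : cancel fromV_fun toV.
Proof. by move=> v; rewrite /= mkAE mkBE -scalerDl eAB scale1r. Qed.

Lemma fromV_linear : linear fromV_fun.
Proof.
move=> u v w; apply: (can_inj toVK).
by rewrite linearP !fromVK.
Qed.
Definition fromV : {linear V -> quad_mod quadV} := mk_lin fromV_linear.

End Peirce.

Lemma QuadMod_es : essentially_surjective QuadMod.
Proof.
move=> V; exists (quadV V), (toV V), (fromV V); split; apply: lin_ext.
  exact: toVK.
exact: fromVK.
Qed.

Theorem quad_module_equivalence :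
  fully_faithful QuadMod /\ essentially_surjective QuadMod.
Proof. exact: (conj QuadMod_ff QuadMod_es). Qed.

End QuadModule.

(* Main.v *)
(* The counit of (T_A, U_A) at (X, Y)_{f,g} is (1, f), whose kernel is
   (0, Ker f)_{0,0}; so condition (P) says that f is injective for every
   projective (X, Y)_{f,g}.  The quadruple T_B(B) = (N (x) B, B)_{Phi_B, 1} is
   projective because U_B, having the right adjoint H_B, preserves epimorphisms;
   its f is phi up to the isomorphism N (x) B = N, which gives one direction.
   Conversely, every (X, Y)_{f,g} is a quotient of T_A(X) (+) T_B(V) with V the
   free B-module on the set Y.  If phi is injective then so is the f of this
   direct sum, coordinatewise on V; a projective is a retract of such a sum,
   and injectivity of f passes to retracts.  The second recollement is the first
   one for the Morita ring with A and B exchanged. *)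
Require Import Defs.
From mathcomp Require Import all_boot all_algebra.
From HB Require Import structures.
From mathcomp Require Import boolp.

Set Implicit Arguments.
Unset Strict Implicit.
Unset Printing Implicit Defensive.

Import Defs GRing.Theory.
Local Open Scope ring_scope.

(** * Adjunctions, epimorphisms and projective objects *)

Section Adjoints.
Variables (D E : category) (L : functor D E) (R : functor E D).
Variable adj : adjunction L R.

Lemma adj_transposeK (Y : D) (Z : E) (g : hom (L Y) Z) :
  adj_counit adj Z \c fmap L (fmap R g \c adj_unit adj Y) = g.
Proof. by rewrite fmapM compcA -counit_nat -compcA triangleL compc1. Qed.

(** By naturality of the unit, the transpose of [g \c fmap L e] is the transpose of [g] precomposed
    with [e]; so [e] is cancelled between transposes, which determine the maps. *)
Lemma left_adjoint_epi (X Y : D) (e : hom X Y) :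
  epimorphism e -> epimorphism (fmap L e).
Proof.
move=> e_epi Z g h gh; rewrite -[g]adj_transposeK -[h]adj_transposeK.
congr (_ \c fmap L _); apply: e_epi.
by rewrite -!compcA -!unit_nat !compcA -!fmapM gh.
Qed.

(** Lift the transpose of [h] along [fmap R e], then transpose the lift back. *)
Lemma left_adjoint_projective (P : D) :
    (forall (X Y : E) (e : hom X Y), epimorphism e -> epimorphism (fmap R e)) ->
  projective_object P -> projective_object (L P).
Proof.
move=> R_epi P_proj X Y e h /R_epi e_epi.
have [k ek] := P_proj _ _ _ (fmap R h \c adj_unit adj P) e_epi.
exists (adj_counit adj X \c fmap L k).
by rewrite compcA counit_nat -compcA -fmapM ek adj_transposeK.
Qed.

End Adjoints.

Lemma ker0_inj (U V : zmodType) (f : {additive U -> V}) :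
  (forall u, f u = 0 -> u = 0) -> injective f.
Proof.
move=> f0 u v fuv; apply/eqP; rewrite -subr_eq0; apply/eqP/f0.
by rewrite raddfB fuv subrr.
Qed.

(** * Epimorphisms of modules and projectivity of the regular module *)

Section Modules.
Variable R : pzRingType.

(** The projection onto the cokernel and the zero map agree after [e], so the cokernel vanishes. *)
Lemma mod_epi_surj (U V : lmodType R) (e : {linear U -> V}) :
  @epimorphism (ModCat R) U V e -> forall v, exists u, e u = v.
Proof.
move=> e_epi v.
have /e_epi/(congr1 (fun h : {linear V -> coker e} => h v)) :
    @compc (ModCat R) _ _ _ (coker_pi e) e
      = @compc (ModCat R) _ _ _ (\0 : {linear V -> coker e}) e.
  by apply: lin_ext => u; rewrite !comp_linE coker_pi0.
by rewrite [RHS]/= -(linear0 (coker_pi e)) => /cok_eq[u]; rewrite subr0; exists u.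
Qed.

Lemma scale_at_linear (V : lmodType R) (v : V) : linear (fun a : R^o => (a : R) *: v).
Proof. by move=> a b c; rewrite scalerDl -scalerA. Qed.

Definition scale_at (V : lmodType R) (v : V) : {linear R^o -> V} :=
  mk_lin (scale_at_linear v).

Lemma regular_projective : @projective_object (ModCat R) R^o.
Proof.
move=> X Y e h /mod_epi_surj/(_ (h 1))[x ex].
exists (scale_at x); apply: lin_ext => r.
by rewrite comp_linE linearZ ex -linearZ; congr (h _); rewrite [LHS]mulr1.
Qed.

End Modules.

(** * The unit isomorphism of the tensor product *)

Section TensorFunctor.
Variables (B A : pzRingType) (M : bimod B A).

Lemma tmapK (X Y : lmodType A) (f : {linear X -> Y}) (g : {linear Y -> X}) :
  cancel f g -> cancel (tmap M f) (tmap M g).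
Proof.
move=> fK t; rewrite -tmap_comp -[RHS](tmap_id (X := X)); congr (tmap _ _ _).
exact: lin_ext.
Qed.

Lemma mul_right_bal : balanced (fun (m : M) (a : A^o) => ract m a).
Proof.
split=> [m m' a|m a a'|m c a|b m a]; first exact: ractDl.
- exact: ractDr.
- exact: ractA.
- exact: ractZ.
Qed.

(** The canonical isomorphism from M (x) A to M. *)
Definition tens_regular : {linear tens M A^o -> M} := tlift mul_right_bal.

Lemma tens_regular_inv_linear : linear (fun m : M => m *t (1 : A^o)).
Proof. by move=> b m m'; rewrite tpureDl tpureZl. Qed.

Definition tens_regular_inv : {linear M -> tens M A^o} :=
  mk_lin tens_regular_inv_linear.

Lemma tens_regular_invK : cancel tens_regular_inv tens_regular.
Proof. by move=> m; rewrite [LHS](tliftE mul_right_bal) ract1. Qed.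

Lemma tens_regularK : cancel tens_regular tens_regular_inv.
Proof.
move=> t; elim/tens_ind: t => [|m a|t u IHt IHu]; first by rewrite !linear0.
  by rewrite [tens_regular _](tliftE mul_right_bal) /= tpure_bal; congr tpure; apply: mulr1.
by rewrite !linearD IHt IHu.
Qed.

End TensorFunctor.

(** * Free modules on arbitrary sets *)

Section FreeModule.
Variables (R : pzRingType) (J : choiceType).

(** The bounding list is only asserted to exist, so that elements with the same coordinates are
    equal. *)
Definition finsupp (v : J -> R) := exists s : seq J, forall j, j \notin s -> v j = 0.

Record free := Free { free_fun :> J -> R; free_supp : finsupp free_fun }.

HB.instance Definition _ := gen_eqMixin free.
HB.instance Definition _ := gen_choiceMixin free.

Lemma free_ext (v w : free) : v =1 w -> v = w.
Proof.
case: v w => v hv [w hw] /= /funext e; subst w.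
by rewrite (Prop_irrelevance hv hw).
Qed.

Lemma finsupp0 : finsupp (fun _ => 0).
Proof. by exists [::]. Qed.

Lemma finsuppD (v w : free) : finsupp (fun j => v j + w j).
Proof.
case: v w => v [s hs] [w [t ht]]; exists (s ++ t) => j /=.
by rewrite mem_cat negb_or => /andP[/hs -> /ht ->]; rewrite addr0.
Qed.

Lemma finsuppZ (a : R) (v : free) : finsupp (fun j => a * v j).
Proof. by case: v => v [s hs]; exists s => j /hs /= ->; rewrite mulr0. Qed.

Definition free0 := Free finsupp0.
Definition freeD v w := Free (finsuppD v w).
Definition freeZ a v := Free (finsuppZ a v).
Definition freeN v := freeZ (-1) v.

Lemma freeDA : associative freeD.
Proof. by move=> u v w; apply: free_ext => j /=; rewrite addrA. Qed.
Lemma freeDC : commutative freeD.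
Proof. by move=> v w; apply: free_ext => j /=; rewrite addrC. Qed.
Lemma free0D : left_id free0 freeD.
Proof. by move=> v; apply: free_ext => j /=; rewrite add0r. Qed.
Lemma freeND : left_inverse free0 freeN freeD.
Proof. by move=> v; apply: free_ext => j /=; rewrite mulN1r addNr. Qed.

HB.instance Definition _ := GRing.isZmodule.Build free freeDA freeDC free0D freeND.

Lemma freeZA a b v : freeZ a (freeZ b v) = freeZ (a * b) v.
Proof. by apply: free_ext => j /=; rewrite mulrA. Qed.
Lemma freeZ1 : left_id 1 freeZ.
Proof. by move=> v; apply: free_ext => j /=; rewrite mul1r. Qed.
Lemma freeZDr : right_distributive freeZ +%R.
Proof. by move=> a v w; apply: free_ext => j /=; rewrite mulrDr. Qed.
Lemma freeZDl v : {morph freeZ^~ v : a b / a + b}.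
Proof. by move=> a b; apply: free_ext => j /=; rewrite mulrDl. Qed.

HB.instance Definition _ :=
  GRing.Zmodule_isLmodule.Build R free freeZA freeZ1 freeZDr freeZDl.

Definition free_mod : lmodType R := free.

Lemma coord_linear (j : J) : linear (fun v : free_mod => v j : R^o).
Proof. by []. Qed.
Definition coord (j : J) : {linear free_mod -> R^o} := mk_lin (coord_linear j).

Lemma finsupp_basis j (a : R) : finsupp (fun i => if i == j then a else 0).
Proof. by exists [:: j] => i; rewrite inE => /negPf ->. Qed.

Definition basis_mul_fun j (a : R^o) : free_mod := Free (finsupp_basis j a).

Lemma basis_mul_linear j : linear (basis_mul_fun j).
Proof.
move=> c a b; apply: free_ext => i /=; case: eqP => //= _.
by rewrite mulr0 addr0.
Qed.
Definition basis_mul j : {linear R^o -> free_mod} := mk_lin (basis_mul_linear j).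

Definition coord_part j : {linear free_mod -> free_mod} :=
  comp_lin (basis_mul j) (coord j).

Lemma sum_coord_part s (v : free_mod) i : uniq s ->
  (\sum_(j <- s) coord_part j v) i = if i \in s then v i else 0.
Proof.
elim: s => [|j s IH] /=; first by rewrite big_nil.
move=> /andP[js us]; rewrite big_cons inE.
rewrite -[LHS]/((if i == j then v j else 0) + (\sum_(j <- s) coord_part j v) i).
rewrite IH //; case: eqP => [->|_] /=; last by rewrite add0r.
by rewrite (negPf js) addr0.
Qed.

(** Truth for all sufficiently large finite index sets. Finitely many such properties hold on a
    common list, so finite expansions can be compared term by term. *)
Definition eventually_seq (P : seq J -> Prop) :=
  exists s : seq J, forall s', uniq s' -> {subset s <= s'} -> P s'.

Lemma free_recover (v : free_mod) :
  eventually_seq (fun s => v = \sum_(j <- s) coord_part j v).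
Proof.
have [s hs] := free_supp v; exists s => s' us ss; apply: free_ext => i.
rewrite sum_coord_part //; case: ifPn => // /(contra (ss i)); exact: hs.
Qed.

Variables (V : lmodType R) (F : J -> V).

(** The bounding list comes from choice, and [undup] makes each index count once;
    [comb_fun_eventually] shows that larger lists give the same sum. *)
Definition comb_fun (v : free_mod) : V :=
  \sum_(j <- undup (projT1 (cid (free_supp v)))) v j *: F j.

Lemma comb_fun_eventually (v : free_mod) :
  eventually_seq (fun s => comb_fun v = \sum_(j <- s) v j *: F j).
Proof.
rewrite /comb_fun; case: (cid _) => s hs /=; exists s => s' us' ss.
rewrite [RHS](bigID (mem s)) /= [X in _ = _ + X]big1 => [|j /hs ->]; last exact: scale0r.
rewrite addr0 -[RHS]big_filter; apply: perm_big; apply: uniq_perm.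
- exact: undup_uniq.
- exact: filter_uniq.
- move=> j; rewrite mem_undup mem_filter; case js: (j \in s) => //=.
  by rewrite (ss j js).
Qed.

Lemma eventually_seqI (P Q : seq J -> Prop) :
  eventually_seq P -> eventually_seq Q -> eventually_seq (fun s => P s /\ Q s).
Proof.
move=> [s hs] [t ht]; exists (s ++ t) => u uu su.
by split; [apply: hs | apply: ht] => // j js; apply: su; rewrite mem_cat js ?orbT.
Qed.

Lemma eventually_seq_ex (P : seq J -> Prop) : eventually_seq P -> exists s, P s.
Proof.
move=> [s hs]; exists (undup s); apply: hs => [|j]; first exact: undup_uniq.
by rewrite mem_undup.
Qed.

Lemma comb_linear : linear comb_fun.
Proof.
move=> a v w; have [s [-> [-> ->]]] := eventually_seq_ex
  (eventually_seqI (comb_fun_eventually (a *: v + w))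
    (eventually_seqI (comb_fun_eventually v) (comb_fun_eventually w))).
rewrite scaler_sumr -big_split; apply: eq_bigr => j _ /=.
by rewrite scalerA -scalerDl.
Qed.

Definition comb : {linear free_mod -> V} := mk_lin comb_linear.

Lemma comb_basis j : comb (basis_mul j 1) = F j.
Proof.
have [s hs] := comb_fun_eventually (basis_mul j 1).
(* Adjoining [j] ensures that its term can be split off the sum. *)
rewrite [LHS](hs (undup (j :: s))); last 2 first.
- exact: undup_uniq.
- by move=> i; rewrite mem_undup inE orbC => ->.
rewrite (bigD1_seq j) ?undup_uniq ?mem_undup ?mem_head //=.
rewrite eqxx scale1r big1 ?addr0 // => i /negPf ->; exact: scale0r.
Qed.

End FreeModule.

(** * From [phi] to [Phi] on free modules *)

Section PhiFree.
Variables (A B : pzRingType) (C : morita A B).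
Local Notation M := (bimM C).
Local Notation N := (bimN C).

(** On m (x) (n (x) b) both sides are phi(m (x) n) b, by right linearity of [phi]. *)
Lemma phi_Phi_regular (t : tens M (tens N B^o)) :
  Phi C B^o t = phi C (tmap M (tens_regular N) t).
Proof.
elim/tens_ind: t => [|m t|t u IHt IHu]; first by rewrite !linear0.
  elim/tens_ind: t => [|n b|t u IHt IHu].
  - by rewrite tpure0r !linear0.
  - by rewrite tmapE PhiE [tens_regular N _](tliftE (mul_right_bal N)) phiR.
  - by rewrite tpureDr !linearD IHt IHu.
by rewrite !linearD IHt IHu.
Qed.

Lemma Phi_regular_injP : injective (Phi C B^o) <-> injective (phi C).
Proof.
split=> inj; last first.
  move=> t u; rewrite !phi_Phi_regular => /inj.
  exact: (can_inj (tmapK (@tens_regularK _ _ N))).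
move=> t u tu; apply: (can_inj (tmapK (@tens_regular_invK _ _ N))); apply: inj.
by rewrite !phi_Phi_regular !(tmapK (@tens_regular_invK _ _ N)).
Qed.

(** A tensor involves finitely many free vectors, each with finite support. This replaces the
    commutation of tensor products with infinite direct sums. *)
Lemma tens_free_recover (J : choiceType) (t : tens M (tens N (free_mod B J))) :
  eventually_seq (fun s =>
    t = \sum_(j <- s) tmap M (tmap N (coord_part B j)) t).
Proof.
elim/tens_ind: t => [|m t|t u].
- by exists [::] => s _ _; rewrite big1 // => j _; rewrite linear0.
- elim/tens_ind: t => [|n v|t u].
  + by exists [::] => s _ _; rewrite tpure0r big1 // => j _; rewrite linear0.
  + have [s hs] := free_recover v; exists s => s' us' ss.
    rewrite {1}(hs s' us' ss); elim: s' {us' ss hs} => [|j s' IH].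
      by rewrite !big_nil !tpure0r.
    by rewrite !big_cons !tpureDr IH !tmapE.
  + move=> /eventually_seqI IH /IH [s hs]; exists s => s' us' ss.
    have [et eu] := hs s' us' ss; rewrite tpureDr {1}et {1}eu -big_split.
    by apply: eq_bigr => j _; rewrite linearD.
- move=> /eventually_seqI IH /IH [s hs]; exists s => s' us' ss.
  have [et eu] := hs s' us' ss; rewrite {1}et {1}eu -big_split.
  by apply: eq_bigr => j _; rewrite linearD.
Qed.

(** If [Phi] kills [t], then by naturality it kills every coordinate of [t], which lies in M (x) N
    (x) B; there [Phi] is injective, so all coordinates vanish, and [t] is a finite sum of their
    images. *)
Lemma Phi_free_inj (J : choiceType) :
  injective (phi C) -> injective (Phi C (free_mod B J)).
Proof.
move=> /Phi_regular_injP Phi_inj; apply: ker0_inj => t t0.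
have [s ->] := eventually_seq_ex (tens_free_recover t); apply: big1 => j _.
suff e : tmap M (tmap N (coord B j)) t = 0.
  (* The projection onto the line of index [j] factors through B. *)
  transitivity (tmap M (tmap N (basis_mul B j)) (tmap M (tmap N (coord B j)) t)).
    by rewrite -tmap_comp; congr (tmap _ _ _); apply: lin_ext => u; apply: tmap_comp.
  by rewrite e linear0.
apply: Phi_inj; rewrite linear0.
by rewrite -[LHS](Psi_nat (C := morita_swap C)) t0 linear0.
Qed.

End PhiFree.

(** * Kernels of quadruples and monicity of the counit *)

Section Quads.
Variables (A B : pzRingType) (C : morita A B).
Local Notation M := (bimM C).
Local Notation N := (bimN C).

Lemma quad_surj_epi (p q : quad C) (h : quad_hom p q) :
    (forall x, exists x', qa h x' = x) -> (forall y, exists y', qb h y' = y) ->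
  @epimorphism (QuadCat C) p q h.
Proof.
move=> ha hb r k l kl; apply: quad_hom_ext => [x|y].
  have [x' <-] := ha x; exact: (congr1 (fun u : quad_hom p r => qa u x') kl).
have [y' <-] := hb y; exact: (congr1 (fun u : quad_hom p r => qb u y') kl).
Qed.

(** On M (x) X, the scalar phi(m (x) n) sends k to m (x) Psi(n (x) k), and Psi(n (x) k) = g(n (x)
    f(k)) = 0. This makes (0, Ker f) with zero structure maps a quadruple. *)
Lemma ker_qf_ann (q : quad C) (m : M) (n : N) (k : kermod (qf q)) :
  (phi C (m *t n) : B) *: k = 0.
Proof.
apply: ker_val_inj; rewrite linearZ linear0 /=.
rewrite -(T_A_qfg m n (ker_val k)).
have := @TU_counit2 _ _ C q (n *t ker_val k).
by rewrite tmapE ker_valP tpure0r !linear0 => /= ->; rewrite tpure0r.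
Qed.

Lemma ker_quad_qgf (q : quad C) (n : N) (m : M) (x : zero_mod A) :
  zero_lin (tens N (kermod (qf q))) (zero_mod A)
    (n *t zero_lin (tens M (zero_mod A)) (kermod (qf q)) (m *t x))
  = (psi C (n *t m) : A) *: x.
Proof. by rewrite [x]zero_modP scaler0. Qed.

Lemma ker_quad_qfg (q : quad C) (m : M) (n : N) (k : kermod (qf q)) :
  zero_lin (tens M (zero_mod A)) (kermod (qf q))
    (m *t zero_lin (tens N (kermod (qf q))) (zero_mod A) (n *t k))
  = (phi C (m *t n) : B) *: k.
Proof. by rewrite ker_qf_ann. Qed.

Definition ker_quad (q : quad C) : quad C :=
  @Quad A B C (zero_mod A) (kermod (qf q)) (zero_lin _ _) (zero_lin _ _)
    (@ker_quad_qgf q) (@ker_quad_qfg q).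

Lemma ker_incl1 (q : quad C) t :
  ker_val (qf (ker_quad q) t)
  = qf (T_A_ob C (qX q)) (tmap M (zero_lin (zero_mod A) (qX q)) t).
Proof.
rewrite [LHS]linear0; elim/tens_ind: t => [|m x|t u IHt IHu].
- by rewrite !linear0.
- by rewrite tmapE tpure0r linear0.
- by rewrite !linearD -IHt -IHu addr0.
Qed.

Lemma ker_incl2 (q : quad C) t :
  zero_lin (zero_mod A) (qX q) (qg (ker_quad q) t)
  = qg (T_A_ob C (qX q)) (tmap N (@ker_val _ _ _ (qf q)) t).
Proof.
rewrite [LHS]linear0; elim/tens_ind: t => [|n k|t u IHt IHu].
- by rewrite !linear0.
- have := @TU_counit2 _ _ C q (n *t ker_val k).
  by rewrite !tmapE ker_valP tpure0r !linear0.
- by rewrite !linearD -IHt -IHu addr0.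
Qed.

Definition ker_incl (q : quad C) : quad_hom (ker_quad q) (T_A_ob C (qX q)) :=
  @QuadHom A B C (ker_quad q) (T_A_ob C (qX q)) (zero_lin _ _) ker_val
    (@ker_incl1 q) (@ker_incl2 q).

(** The counit has components 1 and f. If it is monic, the inclusion of its kernel equals the zero
    map, since both become zero after it. *)
Lemma TU_counit_monoP (q : quad C) :
  @monomorphism (QuadCat C) (T_A_ob C (qX q)) q (TU_counit q) <-> injective (qf q).
Proof.
split=> [mono | inj r g h gh]; last first.
  apply: quad_hom_ext => x.
    exact: (congr1 (fun u : quad_hom r q => qa u x) gh).
  exact/inj/(congr1 (fun u : quad_hom r q => qb u x) gh).
apply: ker0_inj => t t0.
(* [zero1] and [zero2] say that the pair of zero maps is a morphism from [ker_quad q]. *)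
have zero1 u : zero_lin (kermod (qf q)) (tens M (qX q)) (qf (ker_quad q) u)
    = qf (T_A_ob C (qX q)) (tmap M (zero_lin (zero_mod A) (qX q)) u).
  by rewrite -ker_incl1 !linear0.
have zero2 u : zero_lin (zero_mod A) (qX q) (qg (ker_quad q) u)
    = qg (T_A_ob C (qX q)) (tmap N (zero_lin (kermod (qf q)) (tens M (qX q))) u).
  rewrite linear0; elim/tens_ind: u => [|n k|u v IHu IHv].
  - by rewrite !linear0.
  - by rewrite tmapE tpure0r linear0.
  - by rewrite !linearD -IHu -IHv addr0.
have /mono : @compc (QuadCat C) (ker_quad q) _ _ (TU_counit q) (ker_incl q)
    = @compc (QuadCat C) (ker_quad q) _ _ (TU_counit q)
        (@QuadHom A B C (ker_quad q) (T_A_ob C (qX q)) _ _ zero1 zero2).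
  apply: quad_hom_ext => // k; rewrite [RHS]linear0; exact: ker_valP.
move=> /(congr1 (fun u : quad_hom (ker_quad q) (T_A_ob C (qX q)) =>
  qb u (ker_sub t0))) e.
by rewrite -(ker_subE t0); exact: e.
Qed.

End Quads.

(** * Direct sums of modules and of quadruples *)

Section DirectSumModule.
Variables (R : pzRingType) (U V W : lmodType R).

Definition sum_mod : lmodType R := (U * V)%type.

Definition fst_lin : {linear sum_mod -> U} := fst.
Definition snd_lin : {linear sum_mod -> V} := snd.

Lemma pair_linear (f : {linear W -> U}) (g : {linear W -> V}) :
  linear (fun w => (f w, g w) : sum_mod).
Proof. by move=> a v w; rewrite !linearP. Qed.

Definition pair_lin (f : {linear W -> U}) (g : {linear W -> V}) :
  {linear W -> sum_mod} := mk_lin (pair_linear f g).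

Lemma copair_linear (f : {linear U -> W}) (g : {linear V -> W}) :
  linear (fun u : sum_mod => f u.1 + g u.2).
Proof. by move=> a v w; rewrite !linearP /= scalerDr addrACA. Qed.

Definition copair_lin (f : {linear U -> W}) (g : {linear V -> W}) :
  {linear sum_mod -> W} := mk_lin (copair_linear f g).

End DirectSumModule.

Lemma tmap_copair (A B : pzRingType) (M : bimod B A) (U V W : lmodType A)
    (f : {linear U -> W}) (g : {linear V -> W}) t :
  tmap M (copair_lin f g) t = tmap M f (tmap M (fst_lin U V) t)
    + tmap M g (tmap M (snd_lin U V) t).
Proof.
elim/tens_ind: t => [|m [u v]|t u IHt IHu]; first by rewrite !linear0 addr0.
  by rewrite !tmapE /= tpureDr.
by rewrite !linearD IHt IHu addrACA.
Qed.

(** The identity of the direct sum is the copairing of the two injections, so [t] is rebuilt from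
    its two projections. *)
Lemma tens_sum_ext (A B : pzRingType) (M : bimod B A) (U V : lmodType A)
    (t : tens M (sum_mod U V)) :
  tmap M (fst_lin U V) t = 0 -> tmap M (snd_lin U V) t = 0 -> t = 0.
Proof.
move=> t1 t2; rewrite -[t]tmap_id.
have -> : id_lin (sum_mod U V)
    = copair_lin (pair_lin (id_lin U) (zero_lin U V))
                 (pair_lin (zero_lin V U) (id_lin V)).
  apply: lin_ext => -[u v]; congr pair; rewrite /= ?addr0 ?add0r //.
by rewrite tmap_copair t1 t2 !linear0 addr0.
Qed.

Section DirectSumQuad.
Variables (A B : pzRingType) (C : morita A B).
Local Notation M := (bimM C).
Local Notation N := (bimN C).
Variables p q : quad C.

Local Notation X := (sum_mod (qX p) (qX q)).
Local Notation Y := (sum_mod (qY p) (qY q)).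

Definition sum_qf : {linear tens M X -> Y} :=
  pair_lin (comp_lin (qf p) (tmap M (fst_lin _ _)))
           (comp_lin (qf q) (tmap M (snd_lin _ _))).
Definition sum_qg : {linear tens N Y -> X} :=
  pair_lin (comp_lin (qg p) (tmap N (fst_lin _ _)))
           (comp_lin (qg q) (tmap N (snd_lin _ _))).

Lemma sum_qfE t : sum_qf t
  = (qf p (tmap M (fst_lin _ _) t), qf q (tmap M (snd_lin _ _) t)).
Proof. by []. Qed.
Lemma sum_qgE t : sum_qg t
  = (qg p (tmap N (fst_lin _ _) t), qg q (tmap N (snd_lin _ _) t)).
Proof. by []. Qed.

Lemma sum_qgf (n : N) (m : M) (x : X) :
  sum_qg (n *t sum_qf (m *t x)) = (psi C (n *t m) : A) *: x.
Proof. by case: x => x x'; rewrite sum_qgE !tmapE sum_qfE !tmapE !qgf. Qed.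
Lemma sum_qfg (m : M) (n : N) (y : Y) :
  sum_qf (m *t sum_qg (n *t y)) = (phi C (m *t n) : B) *: y.
Proof. by case: y => y y'; rewrite sum_qfE !tmapE sum_qgE !tmapE !qfg. Qed.

Definition quad_sum : quad C := @Quad A B C X Y sum_qf sum_qg sum_qgf sum_qfg.

Lemma quad_sum_inj : injective (qf p) -> injective (qf q) -> injective (qf quad_sum).
Proof.
move=> p_inj q_inj; apply: ker0_inj => t /= e.
have [/= e1 e2] : qf p (tmap M (fst_lin _ _) t) = 0 /\ qf q (tmap M (snd_lin _ _) t) = 0.
  by split; [apply: (congr1 fst e) | apply: (congr1 snd e)].
by apply: tens_sum_ext; [apply: p_inj | apply: q_inj]; rewrite linear0.
Qed.

Variables (r : quad C) (h : quad_hom p r) (k : quad_hom q r).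

Lemma quad_copair1 t : copair_lin (qb h) (qb k) (qf quad_sum t)
  = qf r (tmap M (copair_lin (qa h) (qa k)) t).
Proof. by rewrite tmap_copair linearD -!qaf. Qed.
Lemma quad_copair2 t : copair_lin (qa h) (qa k) (qg quad_sum t)
  = qg r (tmap N (copair_lin (qb h) (qb k)) t).
Proof. by rewrite tmap_copair linearD -!qbg. Qed.

Definition quad_copair : quad_hom quad_sum r := QuadHom quad_copair1 quad_copair2.

End DirectSumQuad.

(** * Injectivity of f on projectives, and the first recollement *)

Section ConditionP.
Variables (A B : pzRingType) (C : morita A B).

(** X itself can be used in the first summand because the f of T_A(X) is the identity; the cover has
    to have injective f, not to be projective. *)
Definition free_cover (q : quad C) : quad C :=
  quad_sum (T_A C (qX q)) (T_B C (free_mod B (qY q))).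

(** On the second summand this is the transpose, under (T_B, U_B), of the canonical map from the
    free module on Y to Y. *)
Definition free_cover_map (q : quad C) : quad_hom (free_cover q) q :=
  quad_copair (TU_counit q)
    (quad_comp (adj_counit (rec_jl_j (recollement_B C)) q)
               (fmap (T_B C) (comb (V := qY q) id))).

Lemma free_cover_epi (q : quad C) : @epimorphism (QuadCat C) _ q (free_cover_map q).
Proof.
apply: quad_surj_epi => [x|y].
  by exists (x, 0); rewrite -[LHS]/(x + qa _ 0) linear0 addr0.
exists (0, basis_mul B y 1); rewrite -[LHS]/(qf q 0 + comb (V := qY q) id _).
by rewrite linear0 add0r comb_basis.
Qed.

Lemma free_cover_inj (q : quad C) : injective (phi C) -> injective (qf (free_cover q)).
Proof. by move=> phi_inj; apply: quad_sum_inj => //; apply: Phi_free_inj. Qed.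

Lemma projective_qf_inj (P : quad C) :
  injective (phi C) -> @projective_object (QuadCat C) P -> injective (qf P).
Proof.
(* Lifting the identity of [P] gives a section [s] of its cover. *)
move=> phi_inj /(_ _ _ _ (idc (P : QuadCat C)) (@free_cover_epi P)) [s es].
apply: ker0_inj => t t0.
have s0 : tmap (bimM C) (qa (s : quad_hom P (free_cover P))) t = 0.
  apply: (free_cover_inj phi_inj).
  by rewrite linear0 -[LHS](qaf (s : quad_hom P (free_cover P))) t0 linear0.
have qs : comp_lin (qa (free_cover_map P)) (qa (s : quad_hom P (free_cover P)))
    = id_lin (qX P) := congr1 (fun u : quad_hom P P => qa u) es.
by rewrite -[t]tmap_id -qs tmap_comp s0 linear0.
Qed.

Lemma T_B_regular_projective : @projective_object (QuadCat C) (T_B C B^o).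
Proof.
apply: (left_adjoint_projective (rec_jl_j (recollement_B C))).
  exact: (left_adjoint_epi (rec_j_jr (recollement_B C))).
exact: regular_projective.
Qed.

Lemma phi_injP : injective (phi C) <->
  (forall P : quad C, @projective_object (QuadCat C) P -> injective (qf P)).
Proof.
split=> [phi_inj P|/(_ _ T_B_regular_projective)]; first exact: projective_qf_inj.
(* The f of [T_B C B^o] is [Phi C B^o] by definition. *)
by move/Phi_regular_injP.
Qed.

Lemma condition_P_phi : condition_P (recollement_A C) <-> injective (phi C).
Proof.
by rewrite phi_injP; split=> h P P_proj; apply/TU_counit_monoP/h.
Qed.

End ConditionP.

(** * Monomorphisms of bimodules *)

Section BimoduleMono.
Variables (B A : pzRingType) (U V : bimod B A) (f : bimod_hom U V).

Lemma ker_ract_subproof (k : kermod f) (a : A) : f (ract (ker_val k) a) = 0.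
Proof. by rewrite bimod_funR ker_valP ract0l. Qed.

Definition ker_ract (k : kermod f) (a : A) : kermod f :=
  ker_sub (ker_ract_subproof k a).

Program Definition ker_bimod : bimod B A :=
  @Bimod B A (kermod f) ker_ract _ _ _ _ _.
Next Obligation. by apply: ker_val_inj; rewrite linearD !ker_subE linearD ractDl. Qed.
Next Obligation. by apply: ker_val_inj; rewrite linearD !ker_subE ractDr. Qed.
Next Obligation. by apply: ker_val_inj; rewrite !ker_subE ractA. Qed.
Next Obligation. by apply: ker_val_inj; rewrite !ker_subE ract1. Qed.
Next Obligation. by apply: ker_val_inj; rewrite linearZ !ker_subE linearZ ractZ. Qed.

Definition ker_bimod_incl : bimod_hom ker_bimod U :=
  @BimodHom B A ker_bimod U ker_val (fun k a => ker_subE (ker_ract_subproof k a)).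

Definition zero_bimod : bimod_hom ker_bimod U :=
  @BimodHom B A ker_bimod U (zero_lin _ _) (fun _ a => esym (ract0l U a)).

(** The test object must be a bimodule: right linearity of [f] makes its kernel one, and a monic [f]
    cannot distinguish the inclusion of the kernel from zero. *)
Lemma bimod_monoP : @monomorphism (BimodCat B A) U V f <-> injective f.
Proof.
split=> [mono | inj Z g h gh]; last first.
  apply: bimod_hom_ext => z; exact/inj/(congr1 (fun u : bimod_hom Z V => u z) gh).
apply: ker0_inj => u u0.
have /mono/(congr1 (fun k : bimod_hom ker_bimod U => k (ker_sub u0))) :
    @compc (BimodCat B A) _ _ _ f ker_bimod_incl
      = @compc (BimodCat B A) _ _ _ f zero_bimod.
  by apply: bimod_hom_ext => k; rewrite [RHS](linear0 f); exact: ker_valP.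
by move=> e; rewrite -(ker_subE u0); exact: e.
Qed.

End BimoduleMono.

(** * Exchanging A and B, and the second recollement *)

Section SwapTransport.
Variables (A B : pzRingType) (C : morita A B).

(** [Swap] is an isomorphism of categories with inverse [Unswap], so a test pair is carried back,
    cancelled and carried forward again. *)
Lemma Swap_epi (p q : quad C) (e : quad_hom p q) :
  @epimorphism (QuadCat C) p q e ->
  @epimorphism (QuadCat (morita_swap C)) _ _ (fmap (Swap C) e).
Proof.
move=> e_epi r g h gh.
have /e_epi gh' : quad_comp (fmap (Unswap C) g) e = quad_comp (fmap (Unswap C) h) e.
  exact: (Unswap_eq4 gh).
exact: (congr1 (fmap (Swap C)) gh').
Qed.

Lemma Swap_mono (p q : quad C) (e : quad_hom p q) :
  @monomorphism (QuadCat C) p q e ->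
  @monomorphism (QuadCat (morita_swap C)) _ _ (fmap (Swap C) e).
Proof.
move=> e_mono r g h gh.
have /e_mono gh' : quad_comp e (fmap (Unswap C) g) = quad_comp e (fmap (Unswap C) h).
  exact: (Unswap_eq4 gh).
exact: (congr1 (fmap (Swap C)) gh').
Qed.

Lemma Swap_projective (P : quad C) :
  @projective_object (QuadCat (morita_swap C)) (Swap C P) ->
  @projective_object (QuadCat C) P.
Proof.
move=> P_proj p q e h /Swap_epi e_epi.
have [k ek] := P_proj _ _ _ (fmap (Swap C) h) e_epi.
by exists (fmap (Unswap C) k); apply: (Unswap_eq ek).
Qed.

End SwapTransport.

Lemma condition_P_psi (A B : pzRingType) (C : morita A B) :
  condition_P (recollement_B C) <-> injective (psi C).
Proof.
rewrite -[injective _]/(injective (phi (morita_swap C))) phi_injP.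
split=> h P P_proj.
  (* Swapping twice is definitionally the identity, so [P_proj] already concerns
     [Swap C (Unswap C P)]. *)
  have mono := h _ (@Swap_projective _ _ C (Unswap C P) P_proj).
  exact: (proj1 (TU_counit_monoP P) (Swap_mono mono)).
have /(TU_counit_monoP (Swap C P)) mono :=
  h _ (@Swap_projective _ _ (morita_swap C) (Swap C P) P_proj).
exact: (@Swap_mono _ _ (morita_swap C) _ _ _ mono).
Qed.

Theorem lemma4p5 (A B : pzRingType) (C : morita A B) :
  (condition_P
     (recollement_A C :
        @recollement (ModCat (qring (phi C))) (QuadCat C) (ModCat A)
          (Q_B C) (Z_B C) (P_B C) (T_A C) (U_A C) (H_A C))
   <-> @monomorphism (BimodCat B B) (tens_bimod (bimM C) (bimN C)) (reg_bimod B) (phi C))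
  /\
  (condition_P
     (recollement_B C :
        @recollement (ModCat (qring (psi C))) (QuadCat C) (ModCat B)
          (Q_A C) (Z_A C) (P_A C) (T_B C) (U_B C) (H_B C))
   <-> @monomorphism (BimodCat A A) (tens_bimod (bimN C) (bimM C)) (reg_bimod A) (psi C)).
Proof.
by split; rewrite bimod_monoP; [apply: condition_P_phi | apply: condition_P_psi].
Qed.
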